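(* Let $n,\ell$ be positive integers and $\varepsilon>0$. There exists a family $\mathcal{F}$ of functions from $\{0,1\}^n$ to $\{0,1\}^\ell$ with seed length $$s := \log|\mathcal{F}| = 2\lfloor \ell + \log(n/\ell) + \log(1/\varepsilon^2) - 1\rfloor$$ such that for every classical-quantum state $\rho_{XE}=\sum_{x\in\{0,1\}^n}|x\rangle\langle x|_X\otimes\rho_E^{[x]}$ (with $\operatorname{tr}\rho_E^{[x]}$ the probability of $x$, $\mathcal{H}_E$ finite-dimensional), the state $\rho_{FZE}$ obtained by applying a uniformly random $f\in\mathcal{F}$ satisfies $$e := d_u(Z|FE)_\rho \le 3\varepsilon + \frac12\sqrt{2^{\ell - H^\varepsilon_{\min}(X|E)_\rho + \log(\frac{2}{\varepsilon^2}+1)}}.$$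
   Context: $\log$ is binary. For a family $\mathcal{F}$ of functions $\{0,1\}^n\to\{0,1\}^\ell$, $\rho_{FZE} = \sum_{f}\sum_{z} \frac{1}{|\mathcal{F}|}|f\rangle\langle f|_F\otimes|z\rangle\langle z|_Z\otimes\rho_E^{[f,z]}$ with $\rho_E^{[f,z]}=\sum_{x:f(x)=z}\rho_E^{[x]}$. $\mathcal{S}_\le(\mathcal{H})$: positive semidefinite $\rho$ with $0<\operatorname{tr}\rho\le1$. $\bar F(\rho,\tau)=\operatorname{tr}|\sqrt\rho\sqrt\tau|+\sqrt{(1-\operatorname{tr}\rho)(1-\operatorname{tr}\tau)}$; purified distance $P=\sqrt{1-\bar F^2}$; $\mathcal{B}^\varepsilon(\rho)=\{\tilde\rho\in\mathcal{S}_\le: P(\rho,\tilde\rho)\le\varepsilon\}$. $H_{\min}(A|B)_\rho=\max_{\sigma_B}\sup\{\lambda:\rho_{AB}\le2^{-\lambda}\mathbb{1}_A\otimes\sigma_B\}$ (max over normalized $\sigma_B$); $H^\varepsilon_{\min}(A|B)_\rho=\max_{\tilde\rho_{AB}\in\mathcal{B}^\varepsilon(\rho_{AB})}H_{\min}(A|B)_{\tilde\rho}$. $d_u(A|B)_\rho=\min_{\sigma_B}\frac12\|\rho_{AB}-\omega_A\otimes\sigma_B\|_1$, $\omega_A=\mathbb{1}_A/\dim\mathcal{H}_A$, minimum over positive semidefinite $\sigma_B$ with $\operatorname{tr}\sigma_B=\operatorname{tr}\rho_B$; in $d_u(Z|FE)$ the conditioning system is $F$ and $E$ jointly.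
   Formalization: The seed length s = 2⌊ℓ + log(n/ℓ) + log(1/ε²) − 1⌋ is required to be nonnegative; otherwise (possible only for ε > 1, e.g. n = ℓ = 1, ε = 2, giving s = −4) no family with log|F| = s exists. Families are indexed by seeds, repetitions allowed. *)

(* Defs.v *)
From HB Require Import structures.
From mathcomp Require Import all_boot all_order all_algebra.
From mathcomp Require Import complex mxtens.
From mathcomp Require Import classical_sets boolp reals ereal exp.
Set Implicit Arguments.
Unset Strict Implicit.
Unset Printing Implicit Defensive.
Import Order.TTheory GRing.Theory Num.Theory Num.Def.
Local Open Scope ring_scope.
Local Open Scope classical_set_scope.

Section Quantum.
Variable R : realType.
Local Notation C := R[i].

Definition log2 (x : R) : R := ln x / ln 2.

Definition adj {m n} (A : 'M[C]_(m, n)) : 'M[C]_(n, m) := (map_mx conjC A)^T.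

Definition psdmx {n} (A : 'M[C]_n) : Prop :=
  adj A = A /\ forall v : 'cV[C]_n, 0 <= (adj v *m A *m v) 0 0.

Definition loewner_le {n} (A B : 'M[C]_n) : Prop := psdmx (B - A).

Definition psd_sqrt {n} (A : 'M[C]_n) : 'M[C]_n :=
  let P := spectralmx A in
  adj P *m diag_mx (map_mx sqrtC (spectral_diag A)) *m P.

Definition trR {n} (A : 'M[C]_n) : R := complex.Re (\tr A).

Definition trnorm {m n} (M : 'M[C]_(m, n)) : R :=
  trR (psd_sqrt (adj M *m M)).

Definition subnormalized {n} (rho : 'M[C]_n) : Prop :=
  psdmx rho /\ 0 < trR rho /\ trR rho <= 1.

Definition density {n} (sigma : 'M[C]_n) : Prop :=
  psdmx sigma /\ trR sigma = 1.

Definition gfid {n} (rho tau : 'M[C]_n) : R :=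
  trnorm (psd_sqrt rho *m psd_sqrt tau)
  + Num.sqrt ((1 - trR rho) * (1 - trR tau)).

Definition pdist {n} (rho tau : 'M[C]_n) : R :=
  Num.sqrt (1 - gfid rho tau ^+ 2).

Definition sball {n} (eps : R) (rho : 'M[C]_n) : set 'M[C]_n :=
  [set rt | subnormalized rt /\ pdist rho rt <= eps].

Definition omega (dA : nat) : 'M[C]_dA := (dA%:R)^-1 *: 1%:M.

Definition ptrA {dA dB} (rho : 'M[C]_(dA * dB)) : 'M[C]_dB :=
  \matrix_(j, k) \sum_(i < dA) rho (mxtens_index (i, j)) (mxtens_index (i, k)).

Definition Hmin (dA dB : nat) (rho : 'M[C]_(dA * dB)) : \bar R :=
  ereal_sup [set lam%:E | lam in
    [set lam : R | exists sigma : 'M[C]_dB, density sigma /\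
       loewner_le rho (real_complex R (2 `^ (- lam)) *: ((1%:M : 'M[C]_dA) *t sigma))]].

Definition Hmin_smooth (dA dB : nat) (eps : R) (rho : 'M[C]_(dA * dB)) : \bar R :=
  ereal_sup [set @Hmin dA dB rt | rt in sball eps rho].

Definition du (dA dB : nat) (rho : 'M[C]_(dA * dB)) : R :=
  inf [set trnorm (rho - omega dA *t sigma) / 2 | sigma in
    [set s : 'M[C]_dB | psdmx s /\ \tr s = \tr (ptrA rho)]].

Definition cq_state (n dE : nat) (rhoE : 'I_(2 ^ n) -> 'M[C]_dE)
  : 'M[C]_(2 ^ n * dE) :=
  \sum_(x < 2 ^ n) delta_mx x x *t rhoE x.

Definition rhoEfz (n l dE : nat) (rhoE : 'I_(2 ^ n) -> 'M[C]_dE)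
  (f : 'I_(2 ^ n) -> 'I_(2 ^ l)) (z : 'I_(2 ^ l)) : 'M[C]_dE :=
  \sum_(x < 2 ^ n | f x == z) rhoE x.

(* rho_{Z(FE)} = sum_f sum_z 1/|F| |z><z|_Z (x) |f><f|_F (x) rho_E^[f,z]
   for the family F = {fam k | k < N} (indexed by seeds k) *)
Definition rhoZFE (N n l dE : nat) (fam : 'I_N -> 'I_(2 ^ n) -> 'I_(2 ^ l))
  (rhoE : 'I_(2 ^ n) -> 'M[C]_dE) : 'M[C]_(2 ^ l * (N * dE)) :=
  \sum_(k < N) \sum_(z < 2 ^ l)
     (N%:R)^-1 *: (delta_mx z z *t (delta_mx k k *t rhoEfz rhoE (fam k) z)).

Definition half_sqrt_exp2 (x : \bar R) : \bar R :=
  match x with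
  | EFin r => (2^-1 * Num.sqrt (2 `^ r))%:E
  | +oo%E => +oo%E
  | -oo%E => 0%E
  end.

End Quantum.

Arguments Hmin {R} dA dB rho.
Arguments Hmin_smooth {R} dA dB eps rho.
Arguments du {R} dA dB rho.

(* Main.v *)
Require Import Defs.
From HB Require Import structures.
From mathcomp Require Import all_boot all_order all_algebra all_fingroup.
From mathcomp Require Import pgroup sylow finfield.
From mathcomp Require Import complex mxtens.
From mathcomp Require Import classical_sets boolp reals ereal sequences exp.
From mathcomp Require Import lra ring.
Set Implicit Arguments.
Unset Strict Implicit.
Unset Printing Implicit Defensive.
Import Order.TTheory GRing.Theory Num.Theory.
Local Open Scope ring_scope.

(* The seed is a pair (a, b) in GF(2^m)^2 and x is hashed to the class of b * p_x(a)
   modulo an additive subgroup of index 2^l, where p_x is the polynomial with the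
   blocks of x as coefficients; two inputs collide with probability at most
   2^-l + floor (n / m) / 2^m <= (1 + 4 eps^2) / 2^l.

   Trace norms are bounded through duality, ||M||_1 = Re tr (V M) for a contraction V.
   Let rt be a smoothed state, rt_x its diagonal blocks, rt_E their sum, and
   rt <= mu (1 (x) S). The distance of rho_ZFE from uniform is split through rt,
   comparing with the conditioning state (1 / |F|) (x) rt_E / tr rt. By Fuchs and van de
   Graaf the smoothing costs eps + eps^2 / 2. The rest is bounded by Cauchy-Schwarz
   with the weight tau = rt_E / 2 + S / 4 + (a multiple of 1): writing
   Y_x = tau^(-1/4) rt_x tau^(-1/4), the traces tr (Y_x Y_y) are nonnegative, so that
   the collision bound applies; they sum to at most 2 because rt_E <= 2 tau, and the
   diagonal ones to at most 4 mu because rt_x <= 4 mu tau. *)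

(** * Hashing by polynomial evaluation *)

Lemma injective_into (T : finType) (N : nat) :
  (N <= #|T|)%N -> exists g : 'I_N -> T, injective g.
Proof.
move=> leN; exists (fun i => enum_val (widen_ord leN i)) => i j /enum_val_inj.
by move/(congr1 val) => /= /val_inj.
Qed.

Lemma card_poly_roots_le (K : finFieldType) (r : nat) (p : {poly K}) :
  p != 0 -> (size p <= r.+1)%N -> (#|[set a | root p a]| <= r)%N.
Proof.
move=> p0 sp; rewrite -ltnS (leq_trans _ sp) // cardE.
apply: max_poly_roots => //; last exact: enum_uniq.
by apply/allP => a; rewrite mem_enum inE.
Qed.

(** The additive group of [K] has order 2^m, so it is a 2-group and has a normal subgroup [H] of
    order 2^(m-l); [t] numbers the 2^l cosets of [H]. *)
Lemma exists_truncation (K : finFieldType) (m l : nat) :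
  #|K| = (2 ^ m)%N -> (l <= m)%N ->
  exists (H : {set K}) (t : K -> 'I_(2 ^ l)),
    #|H| = (2 ^ (m - l))%N /\ forall u v, t u = t v -> u - v \in H.
Proof.
move=> cK lem.
have pG : (2.-group [set: K])%g by rewrite /pgroup cardsT cK pnatX pnat_id.
have [H [sHG nHG cH]] : exists H : {group K},
    [/\ H \subset [set: K], (H <| [set: K])%g & #|H| = (2 ^ (m - l))%N].
  have := normal_pgroup pG (normal_refl [group of [set: K]]).
  move=> /(_ (m - l)%N); case.
    by rewrite cardsT cK pfactorK // leq_subr.
  by move=> H [? ? ?]; exists H.
have cQ : (#|rcosets H [set: K]| = 2 ^ l)%N.
  have := Lagrange sHG; rewrite /indexg cardsT cK cH => /eqP.
  rewrite -{2}(subnK lem) expnD eqn_pmul2l ?expn_gt0 //.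
  by move/eqP.
have inQ (u : K) : rcoset H u \in rcosets H [set: K] by apply: imset_f; rewrite inE.
exists H, (fun u => cast_ord cQ (enum_rank_in (inQ u) (rcoset H u))).
split=> // u v /cast_ord_inj /(enum_rank_in_inj (inQ u) (inQ v)) Huv.
have : u \in rcoset H v by rewrite -Huv rcosetE rcoset_refl.
by rewrite /= rcosetE mem_rcoset.
Qed.

(** Let d be the difference of the two polynomials. It has at most r = n %/ m roots a, for which
    every b may collide; at any other a the map sending b to b d(a) is injective, so at most #|H| =
    2^(m-l) values of b collide. Multiplying by 2^l keeps the bound in the natural numbers. *)
Lemma hash_family (m n l : nat) : (0 < m)%N -> (l <= m)%N ->
  exists fam : 'I_(2 ^ (2 * m)) -> 'I_(2 ^ n) -> 'I_(2 ^ l),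
  forall x y, x != y ->
    (#|[set k | fam k x == fam k y]| * 2 ^ l
       <= 2 ^ (2 * m) + n %/ m * 2 ^ m * 2 ^ l)%N.
Proof.
move=> m0 lem; have [K _ cK] := pPrimePowerField (isT : prime 2) m0.
have [H [t [cH tH]]] := @exists_truncation K m l cK lem.
set r := (n %/ m)%N.
(* Any injective encoding will do; r + 1 blocks of m bits suffice because n < (r + 1) m. *)
have [c c_inj] : exists c : 'I_(2 ^ n) -> {ffun 'I_r.+1 -> K}, injective c.
  apply: injective_into; rewrite card_ffun card_ord cK -expnM leq_exp2l //.
  by rewrite mulnC ltnW // ltn_ceil.
pose p x : {poly K} := \poly_(i < r.+1) c x (inord i).
have p_inj : injective p.
  move=> x y pxy; apply: c_inj; apply/ffunP => i.
  have := congr1 (fun q : {poly K} => q`_i) pxy.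
  by rewrite !coef_poly ltn_ord inord_val.
have cKK : #|{: K * K}| = (2 ^ (2 * m))%N by rewrite card_prod cK -expnD addnn mul2n.
pose seed (k : 'I_(2 ^ (2 * m))) : K * K := enum_val (cast_ord (esym cKK) k).
have seed_inj : injective seed by move=> i j /enum_val_inj /cast_ord_inj.
pose h k x := t ((seed k).2 * (p x).[(seed k).1]).
exists h => x y nxy.
pose d := p x - p y.
have d0 : d != 0 by rewrite subr_eq0; apply: contra nxy => /eqP /p_inj ->.
have sd : (size d <= r.+1)%N.
  by rewrite (leq_trans (size_polyD _ _)) // size_polyN geq_max !size_poly.
pose Bad := [set ab : K * K | ab.2 * d.[ab.1] \in H].
have le_Bad : (#|[set k | h k x == h k y]| <= #|Bad|)%N.
  rewrite -(card_imset _ seed_inj); apply/subset_leq_card/fintype.subsetP => ab.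
  case/imsetP => k; rewrite !inE => /eqP /tH; rewrite -mulrBr => hH ->.
  by rewrite /d hornerD hornerN.
have cBad : (#|Bad| <= r * 2 ^ m + 2 ^ m * 2 ^ (m - l))%N.
  have -> : #|Bad| = (\sum_(a : K) #|[set b : K | (b * d.[a])%R \in H]|)%N.
    rewrite -sum1dep_card.
    rewrite (eq_bigr (fun a => \sum_(b | (b * d.[a])%R \in H) 1)%N); last first.
      by move=> a _; rewrite sum1dep_card.
    rewrite pair_big_dep /=; apply: eq_bigl => -[a b] /=.
  by [].
  rewrite (bigID (root d)) /=; apply: leq_add.
    apply: (@leq_trans (\sum_(a | root d a) 2 ^ m)%N).
      by apply: leq_sum => a _; rewrite -cK max_card.
    by rewrite sum_nat_const leq_mul2r -cardsE card_poly_roots_le ?orbT.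
  apply: (@leq_trans (\sum_(a | ~~ root d a) 2 ^ (m - l))%N).
    apply: leq_sum => a; rewrite /root => da.
    rewrite -cH -(card_imset [set b | (b * d.[a])%R \in H] (mulIf da)); apply: subset_leq_card.
    by apply/fintype.subsetP => _ /imsetP[b + ->]; rewrite inE.
  by rewrite sum_nat_const leq_mul2r -cK max_card orbT.
apply: (leq_trans (leq_mul le_Bad (leqnn (2 ^ l)))).
apply: (leq_trans (leq_mul cBad (leqnn (2 ^ l)))).
by rewrite mulnDl -[(_ * _ * _)%N in X in (_ + X)%N]mulnA -expnD subnK // -expnD addnn mul2n addnC.
Qed.

(** * Hermitian and positive semidefinite matrices *)

Section Matrices.
Context {R : realType}.
Local Notation C := R[i].
Local Notation "x %:C" := (real_complex R x).

Lemma adjE m n (A : 'M[C]_(m, n)) i j : adj A i j = Num.conj (A j i).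
Proof. by rewrite !mxE. Qed.

Lemma adj_trmx m n (A : 'M[C]_(m, n)) : (A ^t Num.conj)%sesqui = adj A.
Proof. by rewrite /adj map_trmx. Qed.

Lemma adj_diag n (d : 'rV[C]_n) : adj (diag_mx d) = diag_mx (map_mx Num.conj d).
Proof. by rewrite /adj map_diag_mx tr_diag_mx. Qed.

Lemma adjK m n (A : 'M[C]_(m, n)) : adj (adj A) = A.
Proof. by apply/matrixP => i j; rewrite !adjE conjCK. Qed.

Lemma adjM m n p (A : 'M[C]_(m, n)) (B : 'M[C]_(n, p)) :
  adj (A *m B) = adj B *m adj A.
Proof. by rewrite /adj map_mxM trmx_mul. Qed.

Lemma adjD m n (A B : 'M[C]_(m, n)) : adj (A + B) = adj A + adj B.
Proof. by rewrite /adj map_mxD linearD. Qed.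

Lemma adjN m n (A : 'M[C]_(m, n)) : adj (- A) = - adj A.
Proof. by rewrite /adj map_mxN linearN. Qed.

Lemma adjB m n (A B : 'M[C]_(m, n)) : adj (A - B) = adj A - adj B.
Proof. by rewrite adjD adjN. Qed.

Lemma adj_scale m n (c : R) (A : 'M[C]_(m, n)) : adj (c%:C *: A) = c%:C *: adj A.
Proof.
apply/matrixP => i j; rewrite !mxE rmorphM; congr (_ * _).
exact: (conjc_real c).
Qed.

Lemma adj1 n : adj (1%:M : 'M[C]_n) = 1%:M.
Proof. by rewrite /adj map_scalar_mx rmorph1 tr_scalar_mx. Qed.

Lemma adj0 m n : adj (0 : 'M[C]_(m, n)) = 0.
Proof. by rewrite /adj map_mx0 trmx0. Qed.

Lemma adj_sum m n (I : Type) (r : seq I) (P : pred I) (F : I -> 'M[C]_(m, n)) :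
  adj (\sum_(i <- r | P i) F i) = \sum_(i <- r | P i) adj (F i).
Proof. by apply: big_morph; [exact: adjD | exact: adj0]. Qed.

Lemma trRD n (A B : 'M[C]_n) : trR (A + B) = trR A + trR B.
Proof. by rewrite /trR mxtraceD raddfD. Qed.

Lemma trRN n (A : 'M[C]_n) : trR (- A) = - trR A.
Proof. by rewrite /trR raddfN raddfN. Qed.

Lemma trRB n (A B : 'M[C]_n) : trR (A - B) = trR A - trR B.
Proof. by rewrite trRD trRN. Qed.

Lemma trR0 n : trR (0 : 'M[C]_n) = 0.
Proof. by rewrite /trR mxtrace0. Qed.

Lemma trR_sum n (I : Type) (r : seq I) (P : pred I) (F : I -> 'M[C]_n) :
  trR (\sum_(i <- r | P i) F i) = \sum_(i <- r | P i) trR (F i).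
Proof. by apply: big_morph; [exact: trRD | exact: trR0]. Qed.

Lemma Re_scale (c : R) (z : C) : complex.Re (c%:C * z) = c * complex.Re z.
Proof. by case: z => a b /=; rewrite mul0r subr0. Qed.

Lemma trRZ n (c : R) (A : 'M[C]_n) : trR (c%:C *: A) = c * trR A.
Proof. by rewrite /trR mxtraceZ Re_scale. Qed.

Lemma trRC m n (A : 'M[C]_(m, n)) (B : 'M[C]_(n, m)) : trR (A *m B) = trR (B *m A).
Proof. by rewrite /trR mxtrace_mulC. Qed.

Lemma trR_adj n (A : 'M[C]_n) : trR (adj A) = trR A.
Proof.
rewrite /trR /adj mxtrace_tr /mxtrace !raddf_sum; apply: eq_bigr => i _.
by rewrite mxE; case: (A i i).
Qed.

(** The squared Hilbert-Schmidt norm; [trR (adj A *m B)] is the matching real inner product. *)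
Definition frob m n (A : 'M[C]_(m, n)) : R := trR (adj A *m A).

Lemma frob_ge0 m n (A : 'M[C]_(m, n)) : 0 <= frob A.
Proof.
rewrite /frob /trR /mxtrace raddf_sum; apply: sumr_ge0 => i _.
rewrite mxE raddf_sum; apply: sumr_ge0 => j _; rewrite adjE.
case: (A j i) => a b /=.
by rewrite mulNr opprK addr_ge0 // -expr2 sqr_ge0.
Qed.

Lemma frobZ m n (c : R) (A : 'M[C]_(m, n)) : frob (c%:C *: A) = c ^+ 2 * frob A.
Proof. by rewrite /frob adj_scale -scalemxAl -scalemxAr !trRZ mulrA. Qed.

Lemma frob_adj m n (A : 'M[C]_(m, n)) : frob (adj A) = frob A.
Proof. by rewrite /frob adjK trRC. Qed.

Lemma frobB m n (A B : 'M[C]_(m, n)) :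
  frob (A - B) = frob A + frob B - 2 * trR (adj A *m B).
Proof.
rewrite /frob adjB mulmxBl (mulmxBr (adj A)) (mulmxBr (adj B)).
rewrite !(trRD, trRN).
rewrite -(trR_adj (adj B *m A)) adjM adjK.
by ring.
Qed.

(** Cauchy-Schwarz in arithmetic-geometric form, read off from [frob (A - B) >= 0]. Rescaling [A]
    recovers the sharp form later. *)
Lemma frob_cross_le m n (A B : 'M[C]_(m, n)) :
  trR (adj A *m B) <= (frob A + frob B) / 2.
Proof. by have := frob_ge0 (A - B); rewrite frobB => ?; lra. Qed.

Lemma psd_herm n (A : 'M[C]_n) : psdmx A -> adj A = A.
Proof. by case. Qed.

Lemma psd_conj m n (A : 'M[C]_m) (K : 'M[C]_(m, n)) :
  psdmx A -> psdmx (adj K *m A *m K).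
Proof.
case=> hA pA; split; first by rewrite !adjM adjK hA mulmxA.
by move=> v; have := pA (K *m v); rewrite adjM !mulmxA.
Qed.

Lemma psdD n (A B : 'M[C]_n) : psdmx A -> psdmx B -> psdmx (A + B).
Proof.
case=> hA pA [hB pB]; split; first by rewrite adjD hA hB.
by move=> v; rewrite mulmxDr mulmxDl mxE addr_ge0.
Qed.

Lemma psd0 n : psdmx (0 : 'M[C]_n).
Proof. by split=> [|v]; [exact: adj0 | rewrite mulmx0 mul0mx mxE]. Qed.

Lemma psd_sum n (I : Type) (r : seq I) (P : pred I) (F : I -> 'M[C]_n) :
  (forall i, P i -> psdmx (F i)) -> psdmx (\sum_(i <- r | P i) F i).
Proof.
by move=> F0; apply: (big_ind (@psdmx R n)); [exact: psd0 | exact: psdD | exact: F0].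
Qed.

Lemma psdZ n (c : R) (A : 'M[C]_n) : 0 <= c -> psdmx A -> psdmx (c%:C *: A).
Proof.
move=> c0 [hA pA]; split; first by rewrite adj_scale hA.
move=> v; rewrite -scalemxAr -scalemxAl mxE; apply: mulr_ge0 => //.
by rewrite ler0c.
Qed.

Lemma psd1 n : psdmx (1%:M : 'M[C]_n).
Proof.
split=> [|v]; first exact: adj1.
rewrite mulmx1 mxE; apply: sumr_ge0 => i _; rewrite adjE mulrC.
exact: mul_conjC_ge0.
Qed.

Lemma psd_gram m n (K : 'M[C]_(m, n)) : psdmx (adj K *m K).
Proof. by rewrite -[adj K]mulmx1; apply: psd_conj; apply: psd1. Qed.

(** Functional calculus in the orthonormal basis given by the columns of [adj P]. Since [g] depends
    on the index and not on an eigenvalue, roots, inverses and spectral projections all take this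
    form. *)
Definition fcalc n (P : 'M[C]_n) (g : 'I_n -> R) : 'M[C]_n :=
  adj P *m diag_mx (\row_i (g i)%:C) *m P.

Lemma eq_fcalc n (P : 'M[C]_n) g h : g =1 h -> fcalc P g = fcalc P h.
Proof.
by move=> gh; congr (_ *m diag_mx _ *m _); apply/rowP => i; rewrite !mxE gh.
Qed.

Lemma fcalc_herm n (P : 'M[C]_n) g : adj (fcalc P g) = fcalc P g.
Proof.
rewrite /fcalc !adjM adjK mulmxA; congr (_ *m _ *m _).
rewrite adj_diag; congr diag_mx; apply/rowP => i.
by rewrite !mxE; apply: (conjc_real (g i)).
Qed.

Lemma fcalcD n (P : 'M[C]_n) g h :
  fcalc P (fun i => g i + h i) = fcalc P g + fcalc P h.
Proof.
rewrite /fcalc -mulmxDl -mulmxDr -linearD /=; congr (_ *m diag_mx _ *m _).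
by apply/rowP => i; rewrite !mxE rmorphD.
Qed.

Lemma fcalcB n (P : 'M[C]_n) g h :
  fcalc P (fun i => g i - h i) = fcalc P g - fcalc P h.
Proof.
rewrite /fcalc -mulmxBl -mulmxBr -linearB /=; congr (_ *m diag_mx _ *m _).
by apply/rowP => i; rewrite !mxE rmorphB.
Qed.

Lemma fcalcM n (P : 'M[C]_n) g h : P *m adj P = 1%:M ->
  fcalc P g *m fcalc P h = fcalc P (fun i => g i * h i).
Proof.
move=> PP; rewrite /fcalc !mulmxA -[_ *m P *m adj P]mulmxA PP mulmx1.
rewrite -[_ *m diag_mx _ *m diag_mx _]mulmxA mulmx_diag.
by congr (_ *m diag_mx _ *m _); apply/rowP => i; rewrite !mxE rmorphM.
Qed.

Lemma fcalc1 n (P : 'M[C]_n) : adj P *m P = 1%:M -> fcalc P (fun=> 1) = 1%:M.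
Proof.
move=> PP; rewrite /fcalc; suff -> : diag_mx (\row__ 1%:C) = 1%:M :> 'M[C]_n.
  by rewrite mulmx1.
by apply/matrixP => i j; rewrite !mxE.
Qed.

Lemma fcalc_psd n (P : 'M[C]_n) g : P *m adj P = 1%:M ->
  (forall i, 0 <= g i) -> psdmx (fcalc P g).
Proof.
move=> PP g0; rewrite (@eq_fcalc _ _ _ (fun i => Num.sqrt (g i) * Num.sqrt (g i))).
  by rewrite -fcalcM // -{1}fcalc_herm; apply: psd_gram.
by move=> i; rewrite -expr2 sqr_sqrtr.
Qed.

Lemma fcalc_psd_ge0 n (P : 'M[C]_n) g : P *m adj P = 1%:M ->
  psdmx (fcalc P g) -> forall i, 0 <= g i.
Proof.
move=> PP [_ pH] i.
(* The test vector is the i-th column of [adj P], an eigenvector with eigenvalue [g i]. *)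
have := pH (adj P *m delta_mx i (0 : 'I_1)).
rewrite /fcalc adjM adjK !mulmxA.
rewrite -!(mulmxA _ P (adj P)) PP !mulmx1.
have -> : (adj (delta_mx i (0 : 'I_1) : 'cV[C]_n) *m diag_mx (\row_j (g j)%:C)
           *m delta_mx i (0 : 'I_1)) 0 0 = (g i)%:C.
  rewrite mul_mx_diag mxE (bigD1 i) //= big1 => [|j ji]; rewrite !mxE !eqxx /=.
    by rewrite rmorph1 mul1r mulr1 addr0.
  by rewrite (negPf ji) mulr0.
by rewrite ler0c.
Qed.

(** [P] is the matrix that [psd_sqrt] itself uses, so the square root lies in the same functional
    calculus. Hermitian symmetry makes the complex eigenvalues real. *)
Lemma herm_spectral n (H : 'M[C]_n) : adj H = H ->
  exists (P : 'M[C]_n) (d : 'I_n -> R),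
  [/\ P *m adj P = 1%:M, adj P *m P = 1%:M, H = fcalc P d &
      psdmx H -> (forall i, 0 <= d i) /\
        psd_sqrt H = fcalc P (fun i => Num.sqrt (d i))].
Proof.
move=> hH; set P := spectralmx H.
have tE (A : 'M[C]_n) : (A ^t Num.conj)%sesqui = adj A by rewrite adj_trmx.
have hH' : H \is hermsymmx.
  by apply/is_hermitianmxP; rewrite expr0 scale1r tE hH.
have PP : P *m adj P = 1%:M by rewrite -tE; apply/unitarymxP/spectral_unitarymx.
have PP' : adj P *m P = 1%:M by apply: mulmx1C.
have dR := hermitian_spectral_diag_real hH'.
pose d i := complex.Re (spectral_diag H 0 i).
have dE : spectral_diag H = \row_i (d i)%:C.
  apply/rowP => i; rewrite mxE /d RRe_real //; exact: (mxOverP dR).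
have HE : H = fcalc P d.
  rewrite /fcalc -dE -tE -invmx_unitary; last exact: spectral_unitarymx.
  exact/orthomx_spectralP/hermitian_normalmx.
exists P, d; split; [exact: PP | exact: PP' | exact: HE | move=> pH].
have d0 : forall i, 0 <= d i by apply: (fcalc_psd_ge0 PP); rewrite -HE.
split; first exact: d0.
rewrite /psd_sqrt /fcalc; congr (_ *m diag_mx _ *m _).
apply/rowP => i; rewrite dE !mxE -{1}(sqr_sqrtr (d0 i)) rmorphXn /= sqrCK //.
by rewrite ler0c sqrtr_ge0.
Qed.

Lemma psd_sqrt_spec n (A : 'M[C]_n) : psdmx A ->
  psdmx (psd_sqrt A) /\ psd_sqrt A *m psd_sqrt A = A.
Proof.
move=> pA; have [P [d [PP PP' AE]]] := herm_spectral (psd_herm pA).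
case/(_ pA) => d0 ->; split; first by apply: fcalc_psd => // i; apply: sqrtr_ge0.
rewrite (fcalcM _ _ PP) AE; apply: eq_fcalc => i.
by rewrite -expr2 sqr_sqrtr.
Qed.

Lemma psd_factor n (A : 'M[C]_n) : psdmx A -> exists S : 'M[C]_n, adj S = S /\ A = S *m S.
Proof. by move=> /psd_sqrt_spec[[hS _] SS]; exists (psd_sqrt A). Qed.

Lemma psd_trR_ge0 n (A : 'M[C]_n) : psdmx A -> 0 <= trR A.
Proof.
by case/psd_factor => S [hS ->]; rewrite -{1}hS; apply: frob_ge0.
Qed.

(** With A = S S, cyclicity turns the trace into that of S B S, which is positive semidefinite. *)
Lemma psd_trR_mul_ge0 n (A B : 'M[C]_n) : psdmx A -> psdmx B -> 0 <= trR (A *m B).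
Proof.
case/psd_factor => S [hS ->] pB; rewrite -mulmxA trRC; apply: psd_trR_ge0.
by rewrite -{1}hS; apply: psd_conj.
Qed.

(** * Contractions and the trace norm *)

(** Equivalent to operator norm at most 1. Stated through the pairing, it passes directly to
    adjoints, negatives and compressions, and it combines with [frob_cross_le] without square
    roots. *)
Definition contraction n (V : 'M[C]_n) : Prop :=
  forall m (A B : 'M[C]_(n, m)), trR (adj A *m V *m B) <= (frob A + frob B) / 2.

(** The choice A = V B makes the left side [frob (V *m B)], half of which is absorbed. *)
Lemma contraction_frob n (V : 'M[C]_n) m (B : 'M[C]_(n, m)) :
  contraction V -> frob (V *m B) <= frob B.
Proof.
move=> /(_ m (V *m B) B); rewrite -mulmxA -/(frob (V *m B)); lra.
Qed.

Lemma contraction_adj n (V : 'M[C]_n) : contraction V -> contraction (adj V).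
Proof.
move=> cV m A B; rewrite -trR_adj !adjM !adjK mulmxA.
by rewrite [_ + frob B]addrC; apply: cV.
Qed.

Lemma contraction_compress n p (V : 'M[C]_n) (J : 'M[C]_(n, p)) :
  adj J *m J = 1%:M -> contraction V -> contraction (adj J *m V *m J).
Proof.
move=> JJ cV m A B; have fJ (X : 'M[C]_(p, m)) : frob (J *m X) = frob X.
  by rewrite /frob adjM -mulmxA (mulmxA (adj J)) JJ mul1mx.
by have := cV _ (J *m A) (J *m B); rewrite !fJ adjM !mulmxA.
Qed.

Lemma contraction_psd n (V A : 'M[C]_n) : contraction V -> psdmx A ->
  trR (V *m A) <= trR A.
Proof.
move=> cV /psd_factor[S [hS ->]].
by have := cV _ S S; rewrite /frob hS -mulmxA trRC -mulmxA; lra.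
Qed.

Lemma contraction_opp n (V : 'M[C]_n) : contraction V -> contraction (- V).
Proof.
move=> cV m A B; have := cV _ (- A) B.
by rewrite adjN !(mulmxN, mulNmx) /frob adjN mulNmx mulmxN opprK.
Qed.

(* Polar decomposition: V = |M|^+ M^* is a partial isometry. *)
Lemma trnorm_attained n (M : 'M[C]_n) :
  exists V, contraction V /\ trnorm M = trR (V *m M).
Proof.
have pM := psd_gram M.
have [P [d [PP PP' ME]]] := herm_spectral (psd_herm pM).
case/(_ pM) => d0 SE; set s := fun i => Num.sqrt (d i) in SE.
have sE i : d i = s i * s i by rewrite /s -expr2 sqr_sqrtr.
(* The convention [0^-1 = 0] makes this functional calculus the pseudo-inverse of |M|, kernel
   included. *)
exists (fcalc P (fun i => (s i)^-1) *m adj M); split; last first.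
  rewrite /trnorm SE -mulmxA ME (fcalcM _ _ PP); congr trR; apply: eq_fcalc => i.
  rewrite sE; have [->|s0] := eqVneq (s i) 0; first by rewrite !mulr0.
  by rewrite mulKf.
move=> m A B; set W := fcalc P _.
have hW : adj W = W by apply: fcalc_herm.
have cW : frob (M *m W *m A) <= frob A.
  (* The middle factor is the projection onto the kernel of M: its eigenvalues are 1 where [s i]
     vanishes and 0 elsewhere. *)
  have : 0 <= trR (adj A *m (1%:M - W *m (adj M *m M) *m W) *m A).
    apply/psd_trR_ge0/psd_conj; rewrite ME.
    rewrite (fcalcM _ _ PP) (fcalcM _ _ PP) -(fcalc1 PP') -fcalcB.
    apply: (fcalc_psd PP) => i; rewrite sE.
    have [->|s0] := eqVneq (s i) 0; first by rewrite !(mulr0, mul0r, subr0) ler01.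
    by rewrite mulKf // divff // subrr.
  rewrite mulmxBr mulmxBl mulmx1 trRB subr_ge0.
  by rewrite /frob 2!adjM hW !mulmxA.
have -> : adj A *m (W *m adj M) *m B = adj (M *m W *m A) *m B.
  by rewrite 2!adjM hW !mulmxA.
by apply: (le_trans (frob_cross_le _ _)); lra.
Qed.

Lemma trnorm_le n (M : 'M[C]_n) (c : R) :
  (forall V, contraction V -> trR (V *m M) <= c) -> trnorm M <= c.
Proof. by move=> le_c; have [V [cV ->]] := trnorm_attained M; apply: le_c. Qed.

Lemma trnorm_ge0 n (M : 'M[C]_n) : 0 <= trnorm M.
Proof. by have [pS _] := psd_sqrt_spec (psd_gram M); apply: psd_trR_ge0. Qed.

End Matrices.

(** * Fidelity and trace distance *)

(** The optimal c = x / a turns the hypothesis into x <= b a / x. *)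
Lemma le_sqrt_of_amgm (R : rcfType) (x a b : R) : 0 <= a -> 0 <= b ->
  (forall c, 0 < c -> 2 * x <= c * a + b / c) -> x <= Num.sqrt (a * b).
Proof.
move=> a0 b0 H; have [x0|x0] := leP x 0; first exact: le_trans (sqrtr_ge0 _).
rewrite -(ger0_norm (ltW x0)) -sqrtr_sqr ler_wsqrtr //.
have [a_eq0|a_neq0] := eqVneq a 0.
  (* When a = 0 this c gives 2 x <= x b / (b + 1) < x, a contradiction. *)
  have c0 : 0 < (b + 1) / x by apply: divr_gt0 => //; lra.
  have := H _ c0; rewrite a_eq0 mulr0 add0r invf_div mulrCA mulrA.
  suff : x * b / (b + 1) < x by rewrite [x * b]mulrC; lra.
  by rewrite ltr_pdivrMr; nra.
have a_gt0 : 0 < a by rewrite lt_def a_neq0.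
have := H _ (divr_gt0 x0 a_gt0); rewrite divfK // invf_div => le1.
have : x <= b * a / x by rewrite mulrA in le1; lra.
by rewrite ler_pdivlMr // expr2 [a * b]mulrC.
Qed.

(** Squaring reduces the claim to 4 (ac)(bd) <= (ac + bd)^2. *)
Lemma mul_le_sum_of_sqr (R : realDomainType) (x y a b c d : R) :
  0 <= a -> 0 <= b -> 0 <= c -> 0 <= d ->
  x ^+ 2 = a * b -> y ^+ 2 = c * d -> 2 * (x * y) <= a * c + b * d.
Proof.
move=> a0 b0 c0 d0 xE yE.
have s0 : 0 <= a * c + b * d by rewrite addr_ge0 ?mulr_ge0.
apply: le_trans (ler_norm _) _.
rewrite -(ler_pXn2r (n := 2)) ?nnegrE // real_normK ?num_real //.
rewrite exprMn exprMn xE yE.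
by have := sqr_ge0 (a * c - b * d); nra.
Qed.

(** The measured distributions are (a, c) and (b, d). The difference of the two squares is 4 (a +
    d)(b + c) = 4 (ab + cd + ac + bd), and F^2 <= ab + cd + 2xy with 2xy <= ac + bd. The second
    claim uses 2xy <= ad + bc instead. *)
Lemma binary_fuchs_van_de_graaf (R : rcfType) (F a b c d : R) :
  0 <= a -> 0 <= b -> 0 <= c -> 0 <= d -> 0 <= F ->
  F <= Num.sqrt (a * b) + Num.sqrt (c * d) ->
  (a - b + (d - c)) ^+ 2 + 4 * F ^+ 2 <= (a + c + (b + d)) ^+ 2 /\
  F ^+ 2 <= (a + c) * (b + d).
Proof.
move=> a0 b0 c0 d0 F0; set x := Num.sqrt _; set y := Num.sqrt _ => Fxy.
have xE : x ^+ 2 = a * b by rewrite sqr_sqrtr ?mulr_ge0.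
have yE : y ^+ 2 = c * d by rewrite sqr_sqrtr ?mulr_ge0.
have yE' : y ^+ 2 = d * c by rewrite mulrC.
have xy1 := mul_le_sum_of_sqr a0 b0 c0 d0 xE yE.
have xy2 := mul_le_sum_of_sqr a0 b0 d0 c0 xE yE'.
have : F ^+ 2 <= (x + y) ^+ 2 by rewrite ler_pXn2r // nnegrE (le_trans F0).
by rewrite sqrrD xE yE mulr2n => FF; split; nra.
Qed.

Section Fidelity.
Context {R : realType}.
Local Notation C := R[i].
Local Notation "x %:C" := (real_complex R x).

Lemma contraction_cauchy_schwarz n (V : 'M[C]_n) m (A B : 'M[C]_(n, m)) :
  contraction V -> trR (adj A *m V *m B) <= Num.sqrt (frob A * frob B).
Proof.
move=> cV; apply: le_sqrt_of_amgm; [exact: frob_ge0 | exact: frob_ge0 |].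
move=> c c0; have := cV _ (c%:C *: A) B.
rewrite frobZ adj_scale -2!scalemxAl trRZ => le1.
rewrite -(ler_pM2l c0) mulrDr [c * (_ / c)]mulrC divfK ?gt_eqF //.
by lra.
Qed.

(* Measuring the Jordan decomposition of rho - rt reduces to the two-outcome
   classical case. *)
Lemma fuchs_van_de_graaf n (rho rt : 'M[C]_n) (F := trnorm (psd_sqrt rho *m psd_sqrt rt)) :
  psdmx rho -> psdmx rt ->
  exists P Q : 'M[C]_n,
  [/\ psdmx P, psdmx Q, rho - rt = P - Q,
      (trR P + trR Q) ^+ 2 + 4 * F ^+ 2 <= (trR rho + trR rt) ^+ 2 &
      F ^+ 2 <= trR rho * trR rt].
Proof.
move=> prho prt.
have [[hA _] AA] := psd_sqrt_spec prho; have [[hB _] BB] := psd_sqrt_spec prt.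
rewrite /F; move: (psd_sqrt rho) (psd_sqrt rt) hA hB AA BB => A B hA hB AA BB.
have hH : adj (rho - rt) = rho - rt by rewrite adjB (psd_herm prho) (psd_herm prt).
have [U [d [UU UU' HE _]]] := herm_spectral hH.
(* [Pi] and [Qi] below are the spectral projections of rho - rt for the nonnegative and the negative
   eigenvalues. *)
pose p i : R := if 0 <= d i then 1 else 0.
pose q i : R := if 0 <= d i then 0 else 1.
set Pi := fcalc U p; set Qi := fcalc U q.
have hPi : adj Pi = Pi by apply: fcalc_herm.
have hQi : adj Qi = Qi by apply: fcalc_herm.
have PiPi : Pi *m Pi = Pi.
  rewrite (fcalcM _ _ UU); apply: eq_fcalc => i; rewrite /p.
  by case: ifP => _; rewrite ?mulr1 ?mulr0.
have QiQi : Qi *m Qi = Qi.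
  rewrite (fcalcM _ _ UU); apply: eq_fcalc => i; rewrite /q.
  by case: ifP => _; rewrite ?mulr1 ?mulr0.
have PQ : Pi + Qi = 1%:M.
  rewrite -fcalcD -(fcalc1 UU'); apply: eq_fcalc => i; rewrite /p /q.
  by case: ifP => _; rewrite ?addr0 ?add0r.
have PE0 : fcalc U (fun i => p i * d i) = Pi *m (rho - rt).
  by rewrite HE (fcalcM p d UU).
have QE0 : fcalc U (fun i => q i * - d i) = - (Qi *m (rho - rt)).
  rewrite HE (fcalcM q d UU) -[RHS]add0r -(subrr (fcalc U q)) -!fcalcB.
  by apply: eq_fcalc => i; rewrite subrr sub0r mulrN.
exists (fcalc U (fun i => p i * d i)), (fcalc U (fun i => q i * - d i)).
clearbody Pi Qi.
(* For a projection K, [frob (X *m K)] is the weight of the outcome K in the state X X. *)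
have trE (X K : 'M[C]_n) : adj X = X -> adj K = K -> K *m K = K ->
    frob (X *m K) = trR (K *m (X *m X)).
  move=> hX hK KK; rewrite /frob adjM hX hK mulmxA -(mulmxA K) trRC mulmxA KK.
  by [].
have trX (X : 'M[C]_n) : trR X = trR (Pi *m X) + trR (Qi *m X).
  by rewrite -trRD -mulmxDl PQ mul1mx.
have aE : frob (A *m Pi) = trR (Pi *m rho) by rewrite -AA; apply: trE.
have bE : frob (B *m Pi) = trR (Pi *m rt) by rewrite -BB; apply: trE.
have cE : frob (A *m Qi) = trR (Qi *m rho) by rewrite -AA; apply: trE.
have dE : frob (B *m Qi) = trR (Qi *m rt) by rewrite -BB; apply: trE.
have acE : trR rho = frob (A *m Pi) + frob (A *m Qi) by rewrite aE cE; apply: trX.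
have bdE : trR rt = frob (B *m Pi) + frob (B *m Qi) by rewrite bE dE; apply: trX.
have PE : trR (fcalc U (fun i => p i * d i)) = frob (A *m Pi) - frob (B *m Pi).
  by rewrite aE bE PE0 mulmxBr !(trRD, trRN).
have QE : trR (fcalc U (fun i => q i * - d i)) = frob (B *m Qi) - frob (A *m Qi).
  by rewrite cE dE QE0 mulmxBr !(trRD, trRN) opprD opprK addrC.
(* The fidelity is tr (B V A). It splits along Pi + Qi = 1, and Cauchy-Schwarz bounds each part by
   the square root of a product of two outcome weights. *)
have [V [cV FE]] := trnorm_attained (A *m B).
have split_tr (K : 'M[C]_n) : adj K = K -> K *m K = K ->
    trR (K *m (B *m V *m A)) = trR (adj (B *m K) *m V *m (A *m K)).
  by move=> hK KK; rewrite adjM hB hK !mulmxA [RHS]trRC !mulmxA KK.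
have CS (K : 'M[C]_n) := contraction_cauchy_schwarz (B *m K) (A *m K) cV.
have [] := binary_fuchs_van_de_graaf (frob_ge0 (A *m Pi))
  (frob_ge0 (B *m Pi)) (frob_ge0 (A *m Qi)) (frob_ge0 (B *m Qi))
  (trnorm_ge0 (A *m B)).
  rewrite FE mulmxA trRC mulmxA (trX (B *m V *m A)).
  rewrite (split_tr _ hPi PiPi) (split_tr _ hQi QiQi).
  rewrite [frob (A *m Pi) * _]mulrC [frob (A *m Qi) * _]mulrC.
  exact: (lerD (CS Pi) (CS Qi)).
rewrite -acE -bdE -PE -QE => le1 le2.
split; [| | | exact: le1 | exact: le2].
- by apply: (fcalc_psd UU) => i; rewrite /p; case: ifP; rewrite ?mul1r ?mul0r.
- apply: (fcalc_psd UU) => i; rewrite /q; case: ifP; rewrite ?mul1r ?mul0r //.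
  by move/negbT; rewrite -ltNge oppr_ge0 => /ltW.
- rewrite HE -fcalcB; apply: eq_fcalc => i; rewrite /p /q.
  by case: ifP => _; rewrite !(mul1r, mul0r, subr0, sub0r, opprK).
Qed.

End Fidelity.

(** * Block decompositions *)

Section Blocks.
Context {R : realType}.
Local Notation C := R[i].
Local Notation "x %:C" := (real_complex R x).

(* The isometry |x> (x) 1. *)
Definition emb N d (x : 'I_N) : 'M[C]_(N * d, d) :=
  \matrix_(i, j) (mxtens_unindex i == (x, j))%:R.

Lemma conj_nat (b : nat) : Num.conj (b%:R : C) = b%:R.
Proof. by rewrite rmorph_nat. Qed.

Lemma emb_adj_mulE N d m (x : 'I_N) (M : 'M[C]_(N * d, m)) k j :
  (adj (emb d x) *m M) k j = M (mxtens_index (x, k)) j.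
Proof.
rewrite mxE (bigD1 (mxtens_index (x, k))) //= big1 => [|i ik].
  by rewrite adjE mxE mxtens_indexK eqxx conj_nat mul1r addr0.
rewrite adjE mxE conj_nat; case: eqP => [E|_]; last by rewrite mul0r.
by rewrite -E mxtens_unindexK eqxx in ik.
Qed.

Lemma emb_mulE N d m (x : 'I_N) (B : 'M[C]_(d, m)) i k :
  (emb d x *m B) i k =
  ((mxtens_unindex i).1 == x)%:R * B (mxtens_unindex i).2 k.
Proof.
rewrite mxE (bigD1 (mxtens_unindex i).2) //= big1 => [|l li].
  rewrite mxE addr0 -pair_eqE /= /pair_eq /= eqxx andbT; congr (_%:R * _).
rewrite mxE -pair_eqE /pair_eq /= [_ == l]eq_sym (negPf li) andbF mul0r.
by [].
Qed.

Lemma tens_delta N d (x : 'I_N) (B : 'M[C]_d) :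
  delta_mx x x *t B = emb d x *m B *m adj (emb d x).
Proof.
apply/matrixP => i j.
have -> : emb d x *m B *m adj (emb d x) = adj (emb d x *m adj (emb d x *m B)).
  by rewrite [RHS]adjM adjK.
rewrite adjE emb_mulE adjE rmorphM /= conjCK conj_nat emb_mulE !mxE /=.
by rewrite -mulnb natrM mulrCA mulrA.
Qed.

Lemma emb_isometry N d (x : 'I_N) : adj (emb d x) *m emb d x = 1%:M.
Proof.
apply/matrixP => k l; rewrite emb_adj_mulE !mxE mxtens_indexK.
by rewrite -pair_eqE /pair_eq /= eqxx.
Qed.

Lemma emb_orth N d (x y : 'I_N) : x != y -> adj (emb d x) *m emb d y = 0.
Proof.
move=> xy; apply/matrixP => k l; rewrite emb_adj_mulE !mxE mxtens_indexK.
by rewrite -pair_eqE /pair_eq /= (negPf xy).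
Qed.

Lemma tens_id N d (B : 'M[C]_d) :
  (1%:M : 'M[C]_N) *t B = \sum_x emb d x *m B *m adj (emb d x).
Proof.
under eq_bigr do rewrite -tens_delta.
apply/matrixP => i j; rewrite summxE !mxE (bigD1 (mxtens_unindex i).1) //= big1.
  by rewrite !mxE addr0 eqxx [_ == (mxtens_unindex i).1]eq_sym.
by move=> x xi; rewrite !mxE [_ == x]eq_sym (negPf xi) mul0r.
Qed.

Definition block N d (M : 'M[C]_(N * d)) (x : 'I_N) : 'M[C]_d :=
  adj (emb d x) *m M *m emb d x.

Lemma blockD N d (A B : 'M[C]_(N * d)) x : block (A + B) x = block A x + block B x.
Proof. by rewrite /block mulmxDr mulmxDl. Qed.

Lemma blockN N d (A : 'M[C]_(N * d)) x : block (- A) x = - block A x.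
Proof. by rewrite /block mulmxN mulNmx. Qed.

Lemma block_sum N d (I : Type) (r : seq I) (F : I -> 'M[C]_(N * d)) x :
  block (\sum_(i <- r) F i) x = \sum_(i <- r) block (F i) x.
Proof.
apply: (big_morph (fun A => block A x)) => [A B|]; first exact: blockD.
by rewrite /block mulmx0 mul0mx.
Qed.

Lemma blockZ N d (c : C) (A : 'M[C]_(N * d)) x : block (c *: A) x = c *: block A x.
Proof. by rewrite /block -scalemxAr -scalemxAl. Qed.

Lemma block_psd N d (A : 'M[C]_(N * d)) x : psdmx A -> psdmx (block A x).
Proof. exact: psd_conj. Qed.

Lemma block_emb N d (B : 'I_N -> 'M[C]_d) x :
  block (\sum_y emb d y *m B y *m adj (emb d y)) x = B x.
Proof.
rewrite block_sum (bigD1 x isT) /= big1 => [|y yx].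
  rewrite addr0 /block -!mulmxA emb_isometry mulmx1 mulmxA emb_isometry.
  by rewrite mul1mx.
by rewrite /block !mulmxA emb_orth 1?eq_sym // !mul0mx.
Qed.

Lemma block_cq_state n d (rho : 'I_(2 ^ n) -> 'M[C]_d) x :
  block (cq_state rho) x = rho x.
Proof.
by rewrite /cq_state; under eq_bigr do rewrite tens_delta; rewrite block_emb.
Qed.

Lemma block_tens_id N d (B : 'M[C]_d) x :
  block ((1%:M : 'M[C]_N) *t B) x = B.
Proof. by rewrite tens_id block_emb. Qed.

Lemma trR_emb N d (V : 'M[C]_(N * d)) (B : 'M[C]_d) x :
  trR (V *m (emb d x *m B *m adj (emb d x))) = trR (block V x *m B).
Proof. by rewrite mulmxA trRC /block !mulmxA. Qed.

Lemma sum_trR_block N d (M : 'M[C]_(N * d)) : \sum_x trR (block M x) = trR M.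
Proof.
have E : \sum_x emb d x *m adj (emb d x) = 1%:M :> 'M[C]_(N * d).
  have -> : 1%:M = (1%:M : 'M[C]_N) *t (1%:M : 'M[C]_d).
    apply/matrixP => i j; rewrite !mxE -natrM mulnb.
    by rewrite -(can_eq (@mxtens_unindexK N d)) -pair_eqE.
  by rewrite tens_id; apply: eq_bigr => x _; rewrite mulmx1.
rewrite -[in RHS](mulmx1 M) -E mulmx_sumr trR_sum; apply: eq_bigr => x _.
by rewrite /block mulmxA [RHS]trRC mulmxA.
Qed.

Lemma contraction_block N d (V : 'M[C]_(N * d)) x :
  contraction V -> contraction (block V x).
Proof. by apply: contraction_compress; apply: emb_isometry. Qed.

End Blocks.

(** * Leftover hashing *)

Section LeftoverHashing.
Context {R : realType}.
Local Notation C := R[i].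
Local Notation "x %:C" := (real_complex R x).

(** Since T inverts G, tr (V B) pairs G V G with T B T. For X = G (adj V) G, cyclicity writes
    [frob X] as a pairing of G^2 (adj V) with (adj V) G^2, each of squared norm at most
    [frob (G *m G)] = tr G^4 <= 1. The scale c is optimised later. *)
Lemma weighted_contraction_le n (V B G T : 'M[C]_n) (c : R) :
  contraction V -> adj G = G -> G *m T = 1%:M -> T *m G = 1%:M ->
  trR ((G *m G) *m (G *m G)) <= 1 -> 0 < c ->
  2 * trR (V *m B) <= c + frob (T *m B *m T) / c.
Proof.
move=> cV hG GT TG trG c0.
have [X [XE hX]] : exists X, X = G *m adj V *m G /\ adj X = G *m V *m G.
  by exists (G *m adj V *m G); rewrite 2!adjM hG adjK mulmxA.
have -> : trR (V *m B) = trR (adj X *m (T *m B *m T)).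
  rewrite hX -!mulmxA (mulmxA G T) GT mul1mx.
  by rewrite [RHS]trRC -!mulmxA TG mulmx1.
have hGG : adj (G *m G) = G *m G by rewrite adjM hG.
have fGG : frob (G *m G) <= 1 by rewrite /frob hGG.
have fX : frob X <= 1.
  have -> : frob X = trR (adj (G *m G *m adj V) *m (adj V *m (G *m G))).
    rewrite /frob hX XE (adjM (G *m G)) adjK hGG -!mulmxA trRC.
    by rewrite -!mulmxA.
  apply: (le_trans (frob_cross_le _ _)).
  have := contraction_frob (G *m G) (contraction_adj cV).
  have := contraction_frob (G *m G) cV.
  have -> : frob (G *m G *m adj V) = frob (V *m (G *m G)).
    by rewrite -frob_adj adjM hGG adjK.
  by lra.
have := frob_cross_le (c%:C *: X) (T *m B *m T).
rewrite frobZ adj_scale -scalemxAl trRZ => le1.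
rewrite -(ler_pM2l c0) mulrDr [c * (_ / c)]mulrC divfK ?gt_eqF //.
have : c ^+ 2 * frob X <= c ^+ 2 by rewrite ler_piMr ?sqr_ge0.
by lra.
Qed.

(** The trace of A against T^2 (c D - A) T^2 is nonnegative, and T^2 D T^2 = 1. *)
Lemma trR_conj_sqr_le n (A D T : 'M[C]_n) (c : R) :
  psdmx A -> adj T = T -> loewner_le A (c%:C *: D) ->
  (T *m T) *m D *m (T *m T) = 1%:M ->
  trR ((T *m A *m T) *m (T *m A *m T)) <= c * trR A.
Proof.
move=> pA hT le_AD TDT.
have p1 := psd_conj (T *m T) le_AD.
have := psd_trR_mul_ge0 pA p1.
rewrite adjM hT mulmxBr mulmxBl -scalemxAr -scalemxAl TDT mulmxBr -scalemxAr.
rewrite mulmx1 trRD trRN trRZ subr_ge0.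
by rewrite -!mulmxA trRC -!mulmxA.
Qed.

(** Let S be the sum of all tr (Y_x Y_y) and L = 1 / #|Z|. Expanding the squares, the cross terms
    give -2 L S and the subtracted means #|Z| L^2 S = L S, so -L S remains besides the colliding
    pairs. *)
Lemma sum_frob_bucket m (X Z : finType) (f : X -> Z) (Y : X -> 'M[C]_m) :
  (0 < #|Z|)%N -> (forall x, adj (Y x) = Y x) ->
  \sum_z frob (\sum_(x | f x == z) Y x - (#|Z|%:R^-1)%:C *: \sum_x Y x) =
  \sum_x \sum_y ((f x == f y)%:R - #|Z|%:R^-1) * trR (Y x *m Y y).
Proof.
move=> Z0 hY; set L := #|Z|%:R^-1 : R.
have ipE (P Q : pred X) :
    trR (adj (\sum_(x | P x) Y x) *m \sum_(y | Q y) Y y)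
    = \sum_(x | P x) \sum_(y | Q y) trR (Y x *m Y y).
  rewrite adj_sum mulmx_suml trR_sum; apply: eq_bigr => x _.
  by rewrite hY mulmx_sumr trR_sum.
set S := \sum_x \sum_y trR (Y x *m Y y).
have -> : \sum_x \sum_y ((f x == f y)%:R - L) * trR (Y x *m Y y)
    = \sum_x \sum_y (f x == f y)%:R * trR (Y x *m Y y) - L * S.
  rewrite /S mulr_sumr -sumrB; apply: eq_bigr => x _.
  rewrite mulr_sumr -sumrB; apply: eq_bigr => y _.
  by rewrite mulrBl.
have fE z : frob (\sum_(x | f x == z) Y x - L%:C *: \sum_x Y x) =
    \sum_(x | f x == z) \sum_(y | f y == z) trR (Y x *m Y y) + L ^+ 2 * S
    - 2 * L * \sum_(x | f x == z) \sum_y trR (Y x *m Y y).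
  rewrite frobB frobZ -scalemxAr trRZ /frob !ipE -/S.
  by rewrite mulrA.
rewrite (eq_bigr _ (fun z _ => fE z)) sumrB big_split /=.
rewrite sumr_const.
have -> : \sum_z 2 * L * (\sum_(x | f x == z) \sum_y trR (Y x *m Y y)) = 2 * L * S.
  by rewrite -mulr_sumr /S [in RHS](partition_big f predT).
have -> : \sum_z \sum_(x | f x == z) \sum_(y | f y == z) trR (Y x *m Y y)
    = \sum_x \sum_y (f x == f y)%:R * trR (Y x *m Y y).
  rewrite [RHS](partition_big f predT) //=; apply: eq_bigr => z _.
  apply: eq_bigr => x /eqP <-; rewrite big_mkcond; apply: eq_bigr => y _.
  by rewrite eq_sym; case: eqP; rewrite ?mul1r ?mul0r.
have -> : L ^+ 2 * S *+ #|Z| = L * S.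
  rewrite -mulr_natr /L expr2; field.
  by rewrite pnatr_eq0 -lt0n.
by ring.
Qed.

(** Since [ip] is nonnegative, each pair is bounded by itself: distinct inputs collide beyond the
    rate 1/L with excess at most kappa / L. *)
Lemma sum_collision_le (K X : finType) (col : K -> X -> X -> bool)
    (L kappa : R) (ip : X -> X -> R) :
  0 < L -> 0 <= kappa -> (forall x y, 0 <= ip x y) ->
  (forall x y, x != y ->
     (#|[set k | col k x y]|)%:R <= #|K|%:R * ((1 + kappa) / L)) ->
  \sum_k \sum_x \sum_y ((col k x y)%:R - L^-1) * ip x y <=
  #|K|%:R * (kappa / L * (\sum_x \sum_y ip x y) + \sum_x ip x x).
Proof.
move=> L0 k0 ip0 colP.
rewrite exchange_big /=.
have -> : #|K|%:R * (kappa / L * (\sum_x \sum_y ip x y) + \sum_x ip x x)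
   = \sum_x \sum_y #|K|%:R * (kappa / L + (x == y)%:R) * ip x y.
  rewrite mulr_sumr -big_split mulr_sumr /=; apply: eq_bigr => x _.
  rewrite (bigD1 x) //= [in RHS](bigD1 x) //= eqxx.
  rewrite [in RHS](eq_bigr (fun y => #|K|%:R * (kappa / L) * ip x y)).
    by rewrite -mulr_sumr mulr1n; ring.
  by move=> y yx; rewrite eq_sym (negPf yx) addr0.
apply: ler_sum => x _; rewrite exchange_big /=; apply: ler_sum => y _.
rewrite -mulr_suml ler_wpM2r // sumrB sumr_const -natr_sum.
have kL : 0 <= kappa / L by rewrite divr_ge0 // ltW.
have -> : (\sum_k col k x y)%N = #|[set k | col k x y]|.
  by rewrite -sum1dep_card [RHS]big_mkcond; apply: eq_bigr => k _; case: (col k x y).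
(* A diagonal pair may collide for every seed; the summand 1 in kappa / L + 1 pays for this. *)
have [->|xy] := eqVneq x y.
  apply: (@le_trans _ _ #|K|%:R).
    rewrite lerBlDr (@le_trans _ _ #|K|%:R) ?ler_nat ?max_card //.
    by rewrite lerDl mulrn_wge0 // invr_ge0 ltW.
  by rewrite ler_peMr ?ler0n // lerDr.
rewrite addr0 lerBlDr -[L^-1 *+ _]mulr_natl -mulrDr.
by apply: (le_trans (colP x y xy)); rewrite mulrDl addrC mul1r.
Qed.

End LeftoverHashing.

(** * Hashing a subnormalized state of bounded min-entropy *)

Section DistanceFromUniform.
Context {R : realType}.
Local Notation C := R[i].
Local Notation "x %:C" := (real_complex R x).

Lemma trR1 d : trR (1%:M : 'M[C]_d) = d%:R.
Proof.
by rewrite /trR mxtrace1 -(rmorph_nat (real_complex R)).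
Qed.

(* The weight is tau = A/2 + S/4 + 1/(4d); G and T are tau^(1/4) and tau^(-1/4).
   The last summand only makes tau invertible. *)
Lemma weight_exists d (A S : 'M[C]_d) : psdmx A -> trR A <= 1 -> density S ->
  exists G T : 'M[C]_d, [/\ adj G = G, adj T = T, G *m T = 1%:M & T *m G = 1%:M]
  /\ [/\ trR ((G *m G) *m (G *m G)) <= 1,
         loewner_le A (2%:C *: ((G *m G) *m (G *m G))),
         loewner_le S (4%:C *: ((G *m G) *m (G *m G))) &
         (T *m T) *m ((G *m G) *m (G *m G)) *m (T *m T) = 1%:M].
Proof.
move=> pA A1 [pS S1].
have d0 : (0 : R) < d%:R.
  rewrite ltr0n lt0n; apply/eqP => dE; move: S1; rewrite /trR /mxtrace.
  rewrite big1 => [/eqP|i _]; first by rewrite eq_sym oner_eq0.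
  by have := ltn_ord i; rewrite {2}dE.
(* The summand e 1 has trace 1/4, so tr tau <= 1/2 + 1/4 + 1/4. *)
set e : R := (4 * d%:R)^-1.
have e0 : 0 < e by rewrite invr_gt0 mulr_gt0.
have [tau tauE] : exists tau, tau = 2^-1%:C *: A + 4^-1%:C *: S + e%:C *: 1%:M.
  by eexists.
have half0 : (0 : R) <= 2^-1 by rewrite invr_ge0.
have ge02 : (0 : R) <= 2 by [].
have e2 : 0 <= 2 * e by rewrite mulr_ge0 // ltW.
have e4 : 0 <= 4 * e by rewrite mulr_ge0 // ltW.
have pAS : psdmx (2^-1%:C *: A + 4^-1%:C *: S).
  by apply: psdD; apply: psdZ; rewrite ?invr_ge0.
have pe : psdmx (e%:C *: (1%:M : 'M[C]_d)) by apply: psdZ; [exact: ltW | exact: psd1].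
have ptau : psdmx tau by rewrite tauE; apply: psdD.
have [P [g [PP PP' gE _]]] := herm_spectral (psd_herm ptau).
(* Removing e 1 from tau leaves A/2 + S/4, which is positive semidefinite; hence every eigenvalue is
   at least e. *)
have g0 i : 0 < g i.
  apply: (lt_le_trans e0); rewrite -subr_ge0; move: i.
  apply: (fcalc_psd_ge0 PP); rewrite fcalcB -gE tauE.
  have -> : fcalc P (fun=> e) = e%:C *: 1%:M.
    rewrite -(fcalc1 PP') /fcalc scalemxAl scalemxAr -linearZ.
    congr (_ *m diag_mx _ *m _).
    by apply/rowP => i; rewrite !mxE mulr1.
  by rewrite addrK.
pose h i := Num.sqrt (Num.sqrt (g i)).
have h0 i : h i != 0 by rewrite gt_eqF // !sqrtr_gt0.
have h4 i : h i * h i * (h i * h i) = g i.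
  have -> : h i * h i = Num.sqrt (g i) by rewrite -expr2 sqr_sqrtr // sqrtr_ge0.
  by rewrite -expr2 sqr_sqrtr // ltW.
have [G GE] : exists G, G = fcalc P h by eexists.
have [T TE] : exists T, T = fcalc P (fun i => (h i)^-1) by eexists.
have GT : G *m T = 1%:M.
  rewrite GE TE (fcalcM _ _ PP) -(fcalc1 PP'); apply: eq_fcalc => i.
  by rewrite divff.
have TG : T *m G = 1%:M by apply: mulmx1C.
have G4 : (G *m G) *m (G *m G) = tau.
  rewrite GE (fcalcM _ _ PP) (fcalcM _ _ PP) gE; exact: eq_fcalc.
exists G, T; split.
  by split=> //; rewrite ?GE ?TE fcalc_herm.
rewrite G4; split.
- rewrite tauE !trRD !trRZ trR1 S1 /e invfM -mulrA mulVf ?gt_eqF //.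
  by lra.
- rewrite /loewner_le tauE; have -> : 2%:C *: (2^-1%:C *: A + 4^-1%:C *: S + e%:C *: 1%:M)
    - A = 2^-1%:C *: S + (2 * e)%:C *: 1%:M.
    rewrite !scalerDr !scalerA -!rmorphM divff // scale1r.
    rewrite -(addrA A) (addrC A) addrK (_ : 2 / 4 = 2^-1) //.
    by field.
  exact: (psdD (psdZ half0 pS) (psdZ e2 (psd1 d))).
- rewrite /loewner_le tauE; have -> : 4%:C *: (2^-1%:C *: A + 4^-1%:C *: S + e%:C *: 1%:M)
    - S = 2%:C *: A + (4 * e)%:C *: 1%:M.
    rewrite !scalerDr !scalerA -!rmorphM divff // scale1r addrAC addrK.
    by rewrite (_ : 4 / 2 = 2) //; field.
  exact: (psdD (psdZ ge02 pA) (psdZ e4 (psd1 d))).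
- rewrite -G4; have -> : (T *m T) *m ((G *m G) *m (G *m G)) = G *m G.
    by rewrite !mulmxA -(mulmxA T T G) TG mulmx1 TG mul1mx.
  by rewrite -mulmxA (mulmxA G T) GT mul1mx.
Qed.

Lemma loewner_le_trans n (A B D : 'M[C]_n) :
  loewner_le A B -> loewner_le B D -> loewner_le A D.
Proof. by move=> AB BD; have := psdD BD AB; rewrite subrKA. Qed.

Lemma sum_add_const (m n : nat) (g : 'I_m -> 'I_n -> R) (c : R) :
  \sum_k \sum_z (c + g k z / c) = m%:R * n%:R * c + (\sum_k \sum_z g k z) / c.
Proof.
have E k : \sum_z (c + g k z / c) = n%:R * c + (\sum_z g k z) / c.
  by rewrite big_split /= sumr_const card_ord mulr_natl mulr_suml.
rewrite (eq_bigr _ (fun k _ => E k)) big_split /= sumr_const card_ord mulr_suml.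
by rewrite -[_ *+ m]mulr_natl mulrA.
Qed.

(** Adding [weighted_contraction_le] over all k and z with one common c gives 2 W <= nK nL c + Q /
    c, where Q <= nK (2 kappa / nL + 4 mu) by the collision bound. Optimising c yields the square
    root. *)
Lemma leftover_hashing (nX nL nK : nat) (fam : 'I_nK -> 'I_nX -> 'I_nL)
    d (rt : 'I_nX -> 'M[C]_d) (S : 'M[C]_d) (kappa mu : R)
    (V : 'I_nK -> 'I_nL -> 'M[C]_d) :
  (0 < nL)%N -> (0 < nK)%N -> 0 <= kappa -> 0 <= mu ->
  (forall x y, x != y ->
     (#|[set k | fam k x == fam k y]|)%:R <= nK%:R * ((1 + kappa) / nL%:R)) ->
  (forall x, psdmx (rt x)) -> trR (\sum_x rt x) <= 1 -> density S ->
  (forall x, loewner_le (rt x) (mu%:C *: S)) ->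
  (forall k z, contraction (V k z)) ->
  \sum_k \sum_z trR (V k z *m (\sum_(x | fam k x == z) rt x
                               - (nL%:R^-1)%:C *: \sum_x rt x))
  <= nK%:R * Num.sqrt (2 * kappa + 4 * (nL%:R * mu)).
Proof.
move=> L0 K0 kappa0 mu0 coll prt tr_rt dS rtS cV.
have pE : psdmx (\sum_x rt x) by apply: psd_sum.
have [G [T [[hG hT GT TG] [trG AG SG TGT]]]] := weight_exists pE tr_rt dS.
pose B k z := \sum_(x | fam k x == z) rt x - (nL%:R^-1)%:C *: \sum_x rt x.
pose Y x := T *m rt x *m T.
have pY x : psdmx (Y x) by rewrite /Y -{1}hT; apply: psd_conj.
have TBT k z : T *m B k z *m T =
    \sum_(x | fam k x == z) Y x - (nL%:R^-1)%:C *: \sum_x Y x.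
  rewrite /B /Y mulmxBr mulmxBl -scalemxAr -scalemxAl.
  by rewrite !mulmx_sumr !mulmx_suml.
have L0R : 0 < (nL%:R : R) by rewrite ltr0n.
have K0R : 0 < (nK%:R : R) by rewrite ltr0n.
have ipE : \sum_x \sum_y trR (Y x *m Y y) <= 2.
  have -> : \sum_x \sum_y trR (Y x *m Y y)
      = trR ((T *m (\sum_x rt x) *m T) *m (T *m (\sum_x rt x) *m T)).
    rewrite mulmx_sumr !mulmx_suml trR_sum; apply: eq_bigr => x _.
    by rewrite mulmx_sumr trR_sum.
  have := trR_conj_sqr_le pE hT AG TGT; lra.
have ip_diag : \sum_x trR (Y x *m Y x) <= 4 * mu.
  have le_x x : trR (Y x *m Y x) <= (4 * mu) * trR (rt x).
    apply: (trR_conj_sqr_le (prt x) hT _ TGT).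
    apply: (loewner_le_trans (rtS x)); rewrite /loewner_le.
    have := psdZ mu0 SG; rewrite scalerBr scalerA -rmorphM.
    by rewrite [mu * 4]mulrC.
  apply: (le_trans (ler_sum _ (fun x _ => le_x x))).
  by rewrite -mulr_sumr -trR_sum ler_piMr // mulr_ge0.
have Qle : \sum_k \sum_z frob (T *m B k z *m T)
    <= nK%:R * (kappa / nL%:R * 2 + 4 * mu).
  have -> : \sum_k \sum_z frob (T *m B k z *m T) =
      \sum_k \sum_x \sum_y ((fam k x == fam k y)%:R - nL%:R^-1) * trR (Y x *m Y y).
    apply: eq_bigr => k _.
    have cL : (0 < #|'I_nL|)%N by rewrite card_ord.
    have := sum_frob_bucket (fam k) cL (fun x => psd_herm (pY x)).
    rewrite card_ord => <-; apply: eq_bigr => z _.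
    by rewrite TBT.
  have := @sum_collision_le R 'I_nK 'I_nX (fun k x y => fam k x == fam k y)
    nL%:R kappa (fun x y => trR (Y x *m Y y)) L0R kappa0.
  rewrite card_ord => /(_ (fun x y => psd_trR_mul_ge0 (pY x) (pY y)) coll) le1.
  apply: (le_trans le1); rewrite ler_pM2l //; apply: lerD => //.
  by rewrite ler_wpM2l // divr_ge0 // ltW.
move: Qle; set Q := \sum_k \sum_z frob _ => Qle.
set W := \sum_k _.
have W_le c : 0 < c -> 2 * W <= nK%:R * nL%:R * c + Q / c.
  move=> c0.
  rewrite /Q -sum_add_const.
  rewrite /W mulr_sumr; apply: ler_sum => k _.
  rewrite mulr_sumr; apply: ler_sum => z _.
  exact: (weighted_contraction_le _ (cV k z) hG GT TG trG c0).
rewrite mulrC -ler_pdivrMr //.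
have -> : 2 * kappa + 4 * (nL%:R * mu) = nL%:R * (kappa / nL%:R * 2 + 4 * mu).
  by field; rewrite gt_eqF.
apply: le_sqrt_of_amgm; first exact: ltW.
  by rewrite addr_ge0 ?mulr_ge0 // divr_ge0 // ltW.
move=> c c0; rewrite mulrA ler_pdivrMr //; apply: (le_trans (W_le c c0)).
rewrite mulrDl; apply: lerD; first by rewrite le_eqVlt; apply/orP; left; apply/eqP; ring.
by rewrite ler_pdivrMr // mulrAC divfK ?gt_eqF // mulrC.
Qed.

End DistanceFromUniform.

(** * Partial traces and upper bounds on [du] *)

Section SmoothLeftoverHashing.
Context {R : realType}.
Local Notation C := R[i].
Local Notation "x %:C" := (real_complex R x).

Lemma herm_mxtrace n (A : 'M[C]_n) : adj A = A -> \tr A = (trR A)%:C.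
Proof.
move=> hA; rewrite /trR RRe_real //; apply/CrealP.
by rewrite -[in RHS]hA /adj mxtrace_tr /mxtrace rmorph_sum; apply: eq_bigr => i _; rewrite mxE.
Qed.

Lemma ptrAE dA dB (M : 'M[C]_(dA * dB)) : ptrA M = \sum_x block M x.
Proof.
apply/matrixP => j k; rewrite summxE mxE; apply: eq_bigr => x _.
rewrite /block -mulmxA emb_adj_mulE.
have -> : M *m emb dB x = adj (adj (emb dB x) *m adj M) by rewrite adjM !adjK.
by rewrite adjE emb_adj_mulE adjE conjCK.
Qed.

Lemma trR_tens_id dA dB (S : 'M[C]_dB) :
  trR ((1%:M : 'M[C]_dA) *t S) = dA%:R * trR S.
Proof.
rewrite -sum_trR_block; under eq_bigr do rewrite block_tens_id.
by rewrite sumr_const card_ord mulr_natl.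
Qed.

Lemma psd_tens_id dA dB (S : 'M[C]_dB) :
  psdmx S -> psdmx ((1%:M : 'M[C]_dA) *t S).
Proof.
move=> pS; rewrite tens_id; apply: psd_sum => x _.
by rewrite -{1}[emb dB x]adjK; apply: psd_conj.
Qed.

Lemma omega_tens dA dB (S : 'M[C]_dB) :
  omega R dA *t S = (dA%:R^-1)%:C *: ((1%:M : 'M[C]_dA) *t S).
Proof.
rewrite /omega -(rmorph_nat (real_complex R)) -fmorphV.
by apply/matrixP => i j; rewrite !mxE mulrA.
Qed.

(** Any admissible [S] bounds the infimum, whose set is bounded below by 0. Both traces are real by
    Hermitian symmetry, so equality of [trR] yields the complex trace condition. The factor 2 undoes
    the half in [du]. *)
Lemma du_le dA dB (rho : 'M[C]_(dA * dB)) (S : 'M[C]_dB) (c : R) :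
  psdmx rho -> psdmx S -> trR S = trR rho ->
  (forall V, contraction V ->
     trR (V *m rho) - dA%:R^-1 * trR (V *m (1%:M *t S)) <= 2 * c) ->
  du dA dB rho <= c.
Proof.
move=> prho pS trS le_c.
have le_c' : trnorm (rho - omega R dA *t S) / 2 <= c.
  rewrite ler_pdivrMr // mulrC; apply: trnorm_le => V cV.
  rewrite omega_tens mulmxBr -scalemxAr trRD trRN trRZ; exact: le_c.
apply: le_trans le_c'; apply: ge_inf.
  by exists 0 => _ [s _ <-]; rewrite divr_ge0 // trnorm_ge0.
exists S => //; split=> //.
have pT : psdmx (ptrA rho) by rewrite ptrAE; apply: psd_sum => x _; apply: block_psd.
rewrite (herm_mxtrace (psd_herm pS)) (herm_mxtrace (psd_herm pT)) trS.
by rewrite ptrAE trR_sum sum_trR_block.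
Qed.

(** Conditioning on the marginal, each of the two terms has trace norm at most tr rho. This trivial
    bound serves the parameters for which the claimed bound is at least 1. *)
Lemma du_le_trR dA dB (rho : 'M[C]_(dA * dB)) :
  (0 < dA)%N -> psdmx rho -> du dA dB rho <= trR rho.
Proof.
move=> dA0 prho; have dA0R : 0 < (dA%:R : R) by rewrite ltr0n.
have pT : psdmx (ptrA rho) by rewrite ptrAE; apply: psd_sum => x _; apply: block_psd.
have trT : trR (ptrA rho) = trR rho by rewrite ptrAE trR_sum sum_trR_block.
apply: (du_le prho pT trT) => V cV.
have le1 := contraction_psd cV prho.
have := contraction_psd (contraction_opp cV) (psd_tens_id dA pT).
rewrite mulNmx trRN trR_tens_id trT => le2.
have := ler_wpM2l (ltW (etrans (invr_gt0 _) dA0R)) le2.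
by rewrite mulrA mulVf ?gt_eqF // mul1r mulrN; lra.
Qed.

End SmoothLeftoverHashing.

(** * The hashed state and the cost of smoothing *)

Section MainBound.
Context {R : realType}.
Local Notation C := R[i].
Local Notation "x %:C" := (real_complex R x).

Lemma cq_stateE n d (rhoE : 'I_(2 ^ n) -> 'M[C]_d) :
  cq_state rhoE = \sum_x emb d x *m rhoE x *m adj (emb d x).
Proof. by rewrite /cq_state; under eq_bigr do rewrite tens_delta. Qed.

Lemma psd_emb N d (x : 'I_N) (A : 'M[C]_d) :
  psdmx A -> psdmx (emb d x *m A *m adj (emb d x)).
Proof. by move=> pA; rewrite -{1}[emb d x]adjK; apply: psd_conj. Qed.

Lemma psd_cq_state n d (rhoE : 'I_(2 ^ n) -> 'M[C]_d) :
  (forall x, psdmx (rhoE x)) -> psdmx (cq_state rhoE).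
Proof.
by move=> pE; rewrite cq_stateE; apply: psd_sum => x _; apply: psd_emb.
Qed.

Lemma trR_cq_state n d (rhoE : 'I_(2 ^ n) -> 'M[C]_d) :
  trR (cq_state rhoE) = \sum_x trR (rhoE x).
Proof.
by rewrite -sum_trR_block; apply: eq_bigr => x _; rewrite block_cq_state.
Qed.

Lemma rhoZFE_emb N n l d (fam : 'I_N -> 'I_(2 ^ n) -> 'I_(2 ^ l))
    (rhoE : 'I_(2 ^ n) -> 'M[C]_d) :
  rhoZFE fam rhoE = \sum_k \sum_z (N%:R^-1)%:C *:
    (emb _ z *m (emb _ k *m rhoEfz rhoE (fam k) z *m adj (emb _ k)) *m adj (emb _ z)).
Proof.
apply: eq_bigr => k _; apply: eq_bigr => z _.
by rewrite !tens_delta fmorphV rmorph_nat.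
Qed.

Lemma psd_rhoZFE N n l d (fam : 'I_N -> 'I_(2 ^ n) -> 'I_(2 ^ l))
    (rhoE : 'I_(2 ^ n) -> 'M[C]_d) :
  (forall x, psdmx (rhoE x)) -> psdmx (rhoZFE fam rhoE).
Proof.
move=> pE; rewrite rhoZFE_emb; apply: psd_sum => k _; apply: psd_sum => z _.
have N0 : (0 : R) <= N%:R^-1 by rewrite invr_ge0.
apply: (psdZ N0); do 2 apply: psd_emb.
by apply: psd_sum => x _; apply: pE.
Qed.

(** The state is block diagonal in Z and F, so a dual operator enters only through its doubly
    diagonal blocks. *)
Lemma trR_mul_rhoZFE N n l d (fam : 'I_N -> 'I_(2 ^ n) -> 'I_(2 ^ l))
    (rhoE : 'I_(2 ^ n) -> 'M[C]_d) (V : 'M[C]_(2 ^ l * (N * d))) :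
  trR (V *m rhoZFE fam rhoE) =
  N%:R^-1 * \sum_k \sum_z trR (block (block V z) k *m rhoEfz rhoE (fam k) z).
Proof.
rewrite rhoZFE_emb mulmx_sumr trR_sum mulr_sumr; apply: eq_bigr => k _.
rewrite mulmx_sumr trR_sum mulr_sumr; apply: eq_bigr => z _.
by rewrite -scalemxAr trRZ !trR_emb.
Qed.

Lemma trR_mul_tens_id N N' d (A : 'M[C]_d) (V : 'M[C]_(N' * (N * d))) :
  trR (V *m ((1%:M : 'M[C]_N') *t ((1%:M : 'M[C]_N) *t A))) =
  \sum_k \sum_z trR (block (block V z) k *m A).
Proof.
rewrite exchange_big tens_id mulmx_sumr trR_sum; apply: eq_bigr => z _.
rewrite trR_emb tens_id mulmx_sumr trR_sum; apply: eq_bigr => k _.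
by rewrite trR_emb.
Qed.

Lemma trR_rhoZFE N n l d (fam : 'I_N -> 'I_(2 ^ n) -> 'I_(2 ^ l))
    (rhoE : 'I_(2 ^ n) -> 'M[C]_d) : (0 < N)%N ->
  trR (rhoZFE fam rhoE) = \sum_x trR (rhoE x).
Proof.
move=> N0; rewrite -[rhoZFE _ _]mul1mx trR_mul_rhoZFE.
have E k : \sum_z trR (block (block (1%:M : 'M[C]_(2 ^ l * (N * d))) z) k
      *m rhoEfz rhoE (fam k) z) = \sum_x trR (rhoE x).
  rewrite [RHS](partition_big (fam k) predT) //=; apply: eq_bigr => z _.
  rewrite /block !mulmx1 emb_isometry mulmx1 emb_isometry mul1mx.
  by rewrite /rhoEfz trR_sum.
rewrite (eq_bigr _ (fun k _ => E k)) sumr_const card_ord -[(\sum__ _) *+ N]mulr_natl.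
by rewrite mulrA mulVf ?mul1r // pnatr_eq0 -lt0n.
Qed.

(** As tr rho = 1, the correction term of [gfid] vanishes and F^2 >= 1 - eps^2. Then (tr P + tr Q)^2
    <= (1 + tr rt)^2 - 4 F^2 <= 4 eps^2, and tr rt >= F^2. *)
Lemma sball_jordan n (rho rt : 'M[C]_n) (eps : R) :
  psdmx rho -> trR rho = 1 -> subnormalized rt -> pdist rho rt <= eps ->
  0 < eps -> eps <= 1 ->
  exists P Q : 'M[C]_n, [/\ psdmx P, psdmx Q, rho - rt = P - Q,
    trR P + trR Q <= 2 * eps & 1 - eps ^+ 2 <= trR rt].
Proof.
move=> prho tr1 [prt [t0 t1]] dle eps0 eps1; have eps0' := ltW eps0.
have [P [Q [pP pQ E]]] := fuchs_van_de_graaf prho prt.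
rewrite tr1 mul1r; move: dle; rewrite /pdist /gfid tr1 subrr mul0r sqrtr0 addr0.
move: (trnorm_ge0 (psd_sqrt rho *m psd_sqrt rt)).
move: (trnorm (psd_sqrt rho *m psd_sqrt rt)) => F F0 dle le1 le2.
have F1 : 1 - eps ^+ 2 <= F ^+ 2.
  (* [Num.sqrt] sends negative numbers to 0, so the case F^2 > 1 is separate, and there the claim is
     immediate. *)
  have [s0|s0] := leP 0 (1 - F ^+ 2).
    move: dle; rewrite -(ler_pXn2r (n := 2)) ?nnegrE ?sqrtr_ge0 //.
    by rewrite sqr_sqrtr //; lra.
  by have := sqr_ge0 eps; lra.
exists P, Q; split; [exact: pP | exact: pQ | exact: E | | lra].
have := psd_trR_ge0 pP; have := psd_trR_ge0 pQ; move: (trR P) (trR Q) le1 => p q.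
move=> le1 q0 p0; rewrite -(ler_pXn2r (n := 2)) ?nnegrE ?addr_ge0 ?mulr_ge0 //.
by rewrite exprMn; nra.
Qed.

(** Twice the distance is at most 2 eps for smoothing, sqrt (8 eps^2 + 4 L mu) for hashing with
    kappa = 4 eps^2, and 1 - t <= eps^2 for normalising. The assumption eps <= 1/3 absorbs these
    into the stated form. *)
Lemma smooth_leftover_hashing N n l d (fam : 'I_N -> 'I_(2 ^ n) -> 'I_(2 ^ l))
    (rhoE : 'I_(2 ^ n) -> 'M[C]_d) (eps mu : R) (rt : 'M[C]_(2 ^ n * d))
    (S : 'M[C]_d) :
  (0 < N)%N -> 0 < eps -> eps <= 3^-1 -> 0 <= mu ->
  (forall x y, x != y -> (#|[set k | fam k x == fam k y]|)%:R <=
     N%:R * ((1 + 4 * eps ^+ 2) / (2 ^ l)%:R)) ->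
  (forall x, psdmx (rhoE x)) -> \sum_x trR (rhoE x) = 1 ->
  subnormalized rt -> pdist (cq_state rhoE) rt <= eps ->
  density S -> loewner_le rt (mu%:C *: ((1%:M : 'M[C]_(2 ^ n)) *t S)) ->
  du (2 ^ l) (N * d) (rhoZFE fam rhoE) <=
  3 * eps + 2^-1 * Num.sqrt ((2 ^ l)%:R * mu * (2 / eps ^+ 2 + 1)).
Proof.
move=> N0 eps0 eps3 mu0 coll pE sum1 srt dle dS rtS.
have N0R : 0 < (N%:R : R) by rewrite ltr0n.
have L0 : (0 < 2 ^ l)%N by rewrite expn_gt0.
have [P [Q [pP pQ PQE trPQ t_ge]]] : exists P Q : 'M[C]_(2 ^ n * d),
    [/\ psdmx P, psdmx Q, cq_state rhoE - rt = P - Q,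
        trR P + trR Q <= 2 * eps & 1 - eps ^+ 2 <= trR rt].
  apply: sball_jordan => //; [exact: psd_cq_state | by rewrite trR_cq_state | lra].
have [prt [t0 t1]] := srt.
have [L LE] : exists L, L = (2 ^ l)%:R :> R by eexists.
have L0R : 0 < L by rewrite LE ltr0n.
have [r rE] : exists r, r = block rt by eexists.
have pr x : psdmx (r x) by rewrite rE; apply: block_psd.
have [A AE] : exists A, A = \sum_x r x by eexists.
have pA : psdmx A by rewrite AE; apply: psd_sum.
have [t tE] : exists t, t = trR rt by eexists.
have trA : trR A = t by rewrite AE trR_sum rE tE sum_trR_block.
rewrite -tE in t0 t1 t_ge.
(* Dividing by t restores trace 1, as [du] asks of the conditioning state, since [rt] may be
   subnormalized. *)
have pnA : psdmx ((N%:R^-1 / t)%:C *: A).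
  by apply: psdZ pA; rewrite divr_ge0 ?invr_ge0 ?ler0n // ltW.
apply: (du_le (psd_rhoZFE fam pE) (psd_tens_id N pnA)).
  rewrite trR_rhoZFE // sum1 trR_tens_id trRZ trA.
  by field; rewrite !gt_eqF.
move=> V cV; rewrite trR_mul_rhoZFE trR_mul_tens_id -LE.
have [W WE] : exists W, W = fun k z => block (block V z) k by eexists.
have cW k z : contraction (W k z).
  by rewrite WE; do 2 apply: contraction_block.
have splitE k z : trR (W k z *m rhoEfz rhoE (fam k) z)
    - L^-1 * t^-1 * trR (W k z *m A) =
    trR (W k z *m (\sum_(x | fam k x == z) (rhoE x - r x)))
    + trR (W k z *m (\sum_(x | fam k x == z) r x - (L^-1)%:C *: A))
    + L^-1 * (1 - t^-1) * trR (W k z *m A).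
  rewrite /rhoEfz sumrB mulmxBr mulmxBr -scalemxAr !(trRD, trRN) trRZ.
  by ring.
(* The difference of the x-blocks is P_x - Q_x, which costs at most tr P_x + tr Q_x against a
   contraction. The buckets partition the inputs, so these add up to tr P + tr Q. *)
have le_1 k : \sum_z trR (W k z *m (\sum_(x | fam k x == z) (rhoE x - r x)))
    <= 2 * eps.
  apply: le_trans trPQ; rewrite -(sum_trR_block P) -(sum_trR_block Q) -big_split.
  rewrite [leRHS](partition_big (fam k) predT) //=; apply: ler_sum => z _.
  rewrite mulmx_sumr trR_sum; apply: ler_sum => x _.
  have -> : rhoE x - r x = block P x - block Q x.
    by rewrite -(block_cq_state rhoE x) rE -!blockN -!blockD PQE.
  have := contraction_psd (cW k z) (block_psd x pP).
  have := contraction_psd (contraction_opp (cW k z)) (block_psd x pQ).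
  rewrite mulNmx mulmxBr !(trRD, trRN) => h1 h2.
  by rewrite lerD.
(* The factor 1 - 1/t is at most 0, so the lower bound -t on the trace is what is used. *)
have le_3 k z : L^-1 * (1 - t^-1) * trR (W k z *m A) <= L^-1 * (1 - t).
  have := contraction_psd (contraction_opp (cW k z)) pA.
  rewrite mulNmx trRN trA => h; rewrite -mulrA ler_pM2l ?invr_gt0 //.
  have ti : 1 <= t^-1 by rewrite invf_ge1.
  have tt : t^-1 * t = 1 by rewrite mulVf ?gt_eqF.
  by nra.
have le_2 : \sum_k \sum_z trR (W k z *m (\sum_(x | fam k x == z) r x
      - (L^-1)%:C *: A)) <= N%:R * Num.sqrt (2 * (4 * eps ^+ 2) + 4 * (L * mu)).
  have k0 : 0 <= 4 * eps ^+ 2 by rewrite mulr_ge0 // sqr_ge0.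
  have trA1 : trR (\sum_x r x) <= 1 by rewrite -AE trA.
  have rS x : loewner_le (r x) (mu%:C *: S).
    by rewrite rE; have := block_psd x rtS;
       rewrite /loewner_le blockD blockN blockZ block_tens_id.
  rewrite AE LE.
  exact: (leftover_hashing L0 N0 k0 mu0 coll pr trA1 dS rS cW).
have total : N%:R^-1 * (\sum_k \sum_z trR (W k z *m rhoEfz rhoE (fam k) z))
    - L^-1 * (\sum_k \sum_z trR (W k z *m ((N%:R^-1 / t)%:C *: A)))
    <= 2 * eps + Num.sqrt (2 * (4 * eps ^+ 2) + 4 * (L * mu)) + (1 - t).
  have -> : L^-1 * (\sum_k \sum_z trR (W k z *m ((N%:R^-1 / t)%:C *: A)))
      = N%:R^-1 * \sum_k \sum_z L^-1 * t^-1 * trR (W k z *m A).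
    rewrite !mulr_sumr; apply: eq_bigr => k _; rewrite !mulr_sumr.
    apply: eq_bigr => z _; rewrite -scalemxAr trRZ; ring.
  rewrite -mulrBr -sumrB; under eq_bigr do rewrite -sumrB.
  rewrite ler_pdivrMl //.
  under eq_bigr do under eq_bigr do rewrite splitE.
  under eq_bigr do rewrite !big_split /=.
  rewrite !big_split /= [leRHS]mulrDr [in leRHS](mulrDr _ (2 * eps)).
  apply: lerD; first apply: lerD.
  - apply: (le_trans (ler_sum _ (fun k _ => le_1 k))).
    by rewrite sumr_const card_ord -[leLHS]mulr_natl.
  - exact: le_2.
  - apply: (le_trans (ler_sum _ (fun k _ => ler_sum _ (fun z _ => le_3 k z)))).
    rewrite !sumr_const !card_ord -[leLHS]mulr_natl -[X in _ * X <= _]mulr_natl -LE.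
    by rewrite mulVKf ?gt_eqF.
rewrite WE in total; apply: (le_trans total).
have Lm : 0 <= L * mu by rewrite mulr_ge0 // ltW.
move: Lm t_ge; move: (L * mu) => y y0 t_ge.
(* This holds because 8 eps^2 <= (3 eps)^2; the total linear cost is then 5 eps + eps^2 <= 6 eps. *)
have s1 : Num.sqrt (2 * (4 * eps ^+ 2) + 4 * y) <= 3 * eps + Num.sqrt (4 * y).
  have y4 : 0 <= 4 * y by lra.
  have := sqrtr_ge0 (4 * y); have := sqr_sqrtr y4.
  move: (Num.sqrt (4 * y)) => u uE u0.
  rewrite -(ler_pXn2r (n := 2)) ?nnegrE ?sqrtr_ge0 //; last by nra.
  by rewrite sqr_sqrtr; nra.
have s2 : Num.sqrt (4 * y) <= Num.sqrt (y * (2 / eps ^+ 2 + 1)).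
  apply: ler_wsqrtr; rewrite mulrC ler_wpM2l //.
  have : 18 <= 2 / eps ^+ 2 by rewrite ler_pdivlMr ?exprn_gt0 //; nra.
  by lra.
by nra.
Qed.

End MainBound.

(** * Seed length and min-entropy *)

Section BinaryLogarithm.
Context {R : realType}.
Implicit Types x y q : R.

Lemma ln2_gt0 : 0 < ln (2 : R).
Proof. by apply: ln_gt0; lra. Qed.

Lemma pow2E x : 2 `^ x = expR (x * ln 2).
Proof. by rewrite /powR gt_eqF. Qed.

Lemma pow2D x y : 2 `^ (x + y) = 2 `^ x * 2 `^ y.
Proof. by rewrite !pow2E mulrDl expRD. Qed.

Lemma pow2_log2 q : 0 < q -> 2 `^ (log2 q) = q.
Proof. by move=> q0; rewrite pow2E /log2 divfK ?lnK // gt_eqF // ln2_gt0. Qed.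

Lemma pow2_gt0 x : 0 < 2 `^ x.
Proof. by apply: powR_gt0. Qed.

Lemma ltr_pow2 x y : (2 `^ x < 2 `^ y) = (x < y).
Proof. by rewrite !pow2E ltr_expR ltr_pM2r // ln2_gt0. Qed.

Lemma ler_pow2 x y : (2 `^ x <= 2 `^ y) = (x <= y).
Proof. by rewrite !leNgt ltr_pow2. Qed.

Lemma pow2_nat n : 2 `^ n%:R = (2 ^ n)%:R :> R.
Proof. by rewrite powR_mulrn // natrX. Qed.

Lemma half_sqrt_exp2_ge0 (a : \bar R) : (0 <= half_sqrt_exp2 a)%E.
Proof.
by case: a => [r| |] //=.
Qed.

(* half_sqrt_exp2 is antitone in the entropy, so a bound at every admissible
   exponent passes to the supremum. *)
Lemma le_half_sqrt_exp2_ereal_sup (I : Type) (D e a b : R) (U : set I)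
    (T : I -> set R) :
  (forall i lam, U i -> T i lam -> D <= e + 2^-1 * Num.sqrt (2 `^ (a + b - lam))) ->
  (D%:E <= e%:E + half_sqrt_exp2 (a%:E
     - ereal_sup [set ereal_sup [set lam%:E | lam in T i] | i in U] + b%:E))%E.
Proof.
move=> H; have [De|eD] := leP D e.
  apply: (@le_trans _ _ e%:E); first by rewrite lee_fin.
  by rewrite leeDl // half_sqrt_exp2_ge0.
have [dl dlE] : exists dl, dl = D - e by eexists.
have dl0 : 0 < dl by rewrite dlE subr_gt0.
have d4 : 0 < (2 * dl) ^+ 2 by rewrite exprn_gt0 // mulr_gt0.
(* As D > e, the hypothesis can be solved for lam, giving one real bound for all admissible
   exponents. *)
have le_lam i lam : U i -> T i lam -> lam <= a + b - log2 ((2 * dl) ^+ 2).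
  move=> Ui Tlam; have := H _ _ Ui Tlam => le1.
  suff : log2 ((2 * dl) ^+ 2) <= a + b - lam by lra.
  rewrite -ler_pow2 pow2_log2 // -[leRHS]sqr_sqrtr; last exact: ltW (pow2_gt0 _).
  have h2 : 2 * dl <= Num.sqrt (2 `^ (a + b - lam)) by lra.
  have h0 : 0 <= 2 * dl by lra.
  by rewrite ler_pXn2r // nnegrE sqrtr_ge0.
have : (ereal_sup [set ereal_sup [set lam%:E | lam in T i] | i in U]
    <= (a + b - log2 ((2 * dl) ^+ 2))%:E)%E.
  apply: ge_ereal_sup => _ [i Ui <-]; apply: ge_ereal_sup => _ [lam Tlam <-].
  by rewrite lee_fin; apply: le_lam Ui Tlam.
(* The bound just proved excludes +oo; a supremum -oo makes the right side +oo. *)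
move: (ereal_sup _) => [h| |] //= le_h; last by rewrite addey // leey.
rewrite -EFinD lee_fin; rewrite lee_fin in le_h.
suff : 2 * dl <= Num.sqrt (2 `^ (a - h + b)) by lra.
have -> : 2 * dl = Num.sqrt ((2 * dl) ^+ 2).
  by rewrite sqrtr_sqr ger0_norm // mulr_ge0 // ltW.
rewrite ler_wsqrtr // -(pow2_log2 d4) ler_pow2; lra.
Qed.

(* 2^m exceeds 2^(X-1), and X is chosen so that this makes the collision
   probability at most (1 + 4 eps^2) / 2^l. *)
Lemma hash_family_floor (n l s : nat) (eps : R) :
  (0 < l)%N -> (l <= n)%N -> 0 < eps -> eps <= 3^-1 ->
  s%:Z = 2 * Num.floor (l%:R + log2 (n%:R / l%:R) + log2 (1 / eps ^+ 2) - 1) ->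
  exists fam : 'I_(2 ^ s) -> 'I_(2 ^ n) -> 'I_(2 ^ l), forall x y : 'I_(2 ^ n), x != y ->
    (#|[set k | fam k x == fam k y]|)%:R <=
      (2 ^ s)%:R * ((1 + 4 * eps ^+ 2) / (2 ^ l)%:R) :> R.
Proof.
move=> l0 ln eps0 eps3; set X := _ - 1; move=> sE.
have l0R : 0 < (l%:R : R) by rewrite ltr0n.
have nl : 1 <= n%:R / l%:R :> R by rewrite ler_pdivlMr // mul1r ler_nat.
have e9 : 9 <= 1 / eps ^+ 2 by rewrite ler_pdivlMr ?exprn_gt0 //; nra.
have nl0 : 0 < n%:R / l%:R :> R by lra.
have e0 : 0 < 1 / eps ^+ 2 by lra.
(* The two logarithms are at least 0 and 1, which offsets the -1. Hence the field degree m = floor X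
   is at least l, as the truncation requires. *)
have lX : l%:R <= X.
  rewrite /X.
  have h1 : 0 <= log2 (n%:R / l%:R : R).
    by rewrite -ler_pow2 pow2_log2 // -[0]/(0%:R) pow2_nat expn0.
  have h2 : 1 <= log2 (1 / eps ^+ 2).
    by rewrite -ler_pow2 pow2_log2 // -[X in _ `^ X]/(1%:R) pow2_nat expn1; lra.
  lra.
have [m mE] : exists m : nat, Num.floor X = m%:Z.
  exists `|Num.floor X|%N; rewrite gez0_abs // floor_ge0.
  by apply: le_trans lX; apply: ler0n.
have lm : (l <= m)%N.
  by rewrite -lez_nat -mE floor_ge_int.
have m0 : (0 < m)%N by apply: leq_trans lm.
have -> : s = (2 * m)%N by move: sE; rewrite mE -PoszM => -[].
have [fam famP] := hash_family n m0 lm.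
exists fam => x y /famP; rewrite -(ler_nat R) natrD !natrM.
have L0 : 0 < (2 ^ l)%:R :> R by rewrite ltr0n expn_gt0.
have M0 : 0 < (2 ^ m)%:R :> R by rewrite ltr0n expn_gt0.
have mm : (2 ^ (2 * m))%:R = (2 ^ m)%:R * (2 ^ m)%:R :> R.
  by rewrite mul2n -addnn expnD natrM.
(* From X < m + 1 one gets 2^(X+1) <= 4 2^m, while 2^(X+1) = 2^l (n / l) / eps^2 by the choice of
   X. *)
have big : (2 ^ l)%:R * (n%:R / l%:R) <= 4 * eps ^+ 2 * (2 ^ m)%:R :> R.
  have : 2 `^ (X + 1) <= 2 * 2 * (2 ^ m)%:R :> R.
    have -> : 2 * 2 * (2 ^ m)%:R = 2 `^ (m.+2%:R) :> R.
      by rewrite pow2_nat !expnS !natrM mulrA.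
    rewrite ler_pow2; have := floorD1_gt X; rewrite mE.
    rewrite -!natr1 rmorphD /= => /ltW; lra.
  rewrite /X subrK !pow2D pow2_nat !pow2_log2 // => h.
  have ee : eps ^+ 2 * (1 / eps ^+ 2) = 1 by rewrite mulrC divfK // expf_neq0 // gt_eqF.
  have := ler_wpM2l (sqr_ge0 eps) h.
  rewrite mulrCA ee mulr1; lra.
have nm : (n %/ m)%:R <= n%:R / l%:R :> R.
  rewrite ler_pdivlMr // -natrM ler_nat; apply: leq_trans (leq_trunc_div n m).
  by rewrite leq_mul2l lm orbT.
move=> h; rewrite mulrA ler_pdivlMr //; apply: (le_trans h).
rewrite mm mulrDr mulr1 lerD2l.
have : (n %/ m)%:R * (2 ^ l)%:R <= 4 * eps ^+ 2 * (2 ^ m)%:R :> R.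
  by apply: le_trans big; rewrite mulrC ler_pM2l.
move=> h2; have := ler_wpM2l (ltW M0) h2; lra.
Qed.

End BinaryLogarithm.

(** * Choice of the family, with degenerate parameters treated apart *)

Theorem theorem4 (R : realType) (n l : nat) (eps : R) :
  (0 < n)%N -> (0 < l)%N -> 0 < eps ->
  forall s : nat,
  s%:Z = 2 * Num.floor (l%:R + log2 (n%:R / l%:R) + log2 (1 / eps ^+ 2) - 1) ->
  exists fam : 'I_(2 ^ s) -> 'I_(2 ^ n) -> 'I_(2 ^ l),
  forall (dE : nat) (rhoE : 'I_(2 ^ n) -> 'M[R[i]]_dE),
    (forall x, psdmx (rhoE x)) ->
    \sum_(x < 2 ^ n) trR (rhoE x) = 1 ->
    ((du (2 ^ l) (2 ^ s * dE) (rhoZFE fam rhoE))%:E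
     <= (3 * eps)%:E
        + half_sqrt_exp2
            (l%:R%:E - Hmin_smooth (2 ^ n) dE eps (cq_state rhoE)
             + (log2 (2 / eps ^+ 2 + 1))%:E))%E.
Proof.
move=> n0 l0 eps0 s sE.
have L0 : (0 < 2 ^ l)%N by rewrite expn_gt0.
have S0 : (0 < 2 ^ s)%N by rewrite expn_gt0.
have du_le_1 (fam : 'I_(2 ^ s) -> 'I_(2 ^ n) -> 'I_(2 ^ l)) dE
    (rhoE : 'I_(2 ^ n) -> 'M[R[i]]_dE) :
    (forall x, psdmx (rhoE x)) -> \sum_(x < 2 ^ n) trR (rhoE x) = 1 ->
    du (2 ^ l) (2 ^ s * dE) (rhoZFE fam rhoE) <= 1.
  move=> pE sum1; apply: le_trans (du_le_trR L0 (psd_rhoZFE fam pE)) _.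
  by rewrite trR_rhoZFE // sum1.
(* The suprema are removed: it suffices to bound [du] for each smoothed state and feasible exponent.
   The case distinctions that follow involve only eps, n and l, so the family is fixed before the
   state. *)
suff [fam famP] : exists fam : 'I_(2 ^ s) -> 'I_(2 ^ n) -> 'I_(2 ^ l),
    forall (dE : nat) (rhoE : 'I_(2 ^ n) -> 'M[R[i]]_dE) rt S lam,
    (forall x, psdmx (rhoE x)) -> \sum_(x < 2 ^ n) trR (rhoE x) = 1 ->
    subnormalized rt -> pdist (cq_state rhoE) rt <= eps -> density S ->
    loewner_le rt (real_complex R (2 `^ (- lam)) *: ((1%:M : 'M_(2 ^ n)) *t S)) ->
    du (2 ^ l) (2 ^ s * dE) (rhoZFE fam rhoE) <=
    3 * eps + 2^-1 * Num.sqrt ((2 ^ l)%:R * 2 `^ (- lam) * (2 / eps ^+ 2 + 1)).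
  exists fam => dE rhoE pE sum1; rewrite /Hmin_smooth /Hmin.
  apply: le_half_sqrt_exp2_ereal_sup => rt lam [srt dle] [S [dS le_rt]].
  rewrite !pow2D pow2_nat pow2_log2; last first.
    by rewrite addr_gt0 // divr_gt0 // exprn_gt0.
  by rewrite mulrAC; apply: famP le_rt.
(* For eps > 1/3 the term 3 eps exceeds 1, and a constant family suffices. *)
have [eps3|eps3] := ltP 3^-1 eps.
  exists (fun _ _ => Ordinal L0) => dE rhoE rt S lam pE sum1 _ _ _ _.
  apply: le_trans (du_le_1 _ _ _ pE sum1) _.
  have := sqrtr_ge0 ((2 ^ l)%:R * 2 `^ (- lam) * (2 / eps ^+ 2 + 1)); lra.
have [nl|ln] := leqP n l; last first.
  have [fam coll] := hash_family_floor l0 (ltnW ln) eps0 eps3 sE.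
  exists fam => dE rhoE rt S lam pE sum1 srt dle dS le_rt.
  have mu0 : 0 <= (2 : R) `^ (- lam) by apply: ltW (pow2_gt0 _).
  exact: (smooth_leftover_hashing S0 eps0 eps3 mu0 coll pE sum1 srt dle dS le_rt).
(* If n <= l, the bound exceeds 1: tr rt >= 1 - eps^2 forces the min-entropy
   to be at most n + log2 (9/8). *)
exists (fun _ _ => Ordinal L0) => dE rhoE rt S lam pE sum1 srt dle [pS trS] le_rt.
apply: le_trans (du_le_1 _ _ _ pE sum1) _.
have tr1 : trR (cq_state rhoE) = 1 by rewrite trR_cq_state.
have eps1 : eps <= 1 by lra.
have [_ [_ [_ _ _ _ t_ge]]] :=
  sball_jordan (psd_cq_state pE) tr1 srt dle eps0 eps1.
have := psd_trR_ge0 le_rt; rewrite trRD trRN trRZ trR_tens_id trS mulr1 => t_le.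
have pow0 := pow2_gt0 (- lam).
have nlR : (2 ^ n)%:R <= (2 ^ l)%:R :> R by rewrite ler_nat leq_exp2l.
have q19 : 19 <= 2 / eps ^+ 2 + 1.
  have : 18 <= 2 / eps ^+ 2 by rewrite ler_pdivlMr ?exprn_gt0 //; nra.
  by lra.
have mu_ge : 8 / 9 <= (2 ^ l)%:R * 2 `^ (- lam).
  have := ler_wpM2l (ltW pow0) nlR; have : eps ^+ 2 <= 9^-1 by nra.
  by lra.
(* Indeed 19 * 8/9 > 4, so half the square root alone is at least 1. *)
have ge4 : 4 <= (2 ^ l)%:R * 2 `^ (- lam) * (2 / eps ^+ 2 + 1).
  move: ((2 ^ l)%:R * _) (2 / _ + 1) mu_ge q19 => u v hu hv.
  by have := @ler_pM R (8 / 9) u 19 v; lra.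
have : 2 <= Num.sqrt ((2 ^ l)%:R * 2 `^ (- lam) * (2 / eps ^+ 2 + 1)).
  apply: le_trans (ler_wsqrtr ge4).
  by rewrite (_ : 4 = 2 ^+ 2 :> R) ?sqrtr_sqr ?ger0_norm //; ring.
by lra.
Qed.
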